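(* Let $k$ be a finite field of cardinality $q$, let $G_f=\mathrm{GL}_2(k)$, and let $R$ be an algebraically closed field of odd characteristic $l$ dividing $q+1$. Let $\mathcal{B}_1(G_f)$ be the unipotent block of $R$-representations of $G_f$, and let $Q_f$ and $V_f$ be the representations of $G_f$ defined in the context. Then $$\langle Q_f\rangle_{D^b(\mathcal{B}_1(G_f)_{\mathrm{fg}})}=\langle V_f\rangle_{D^b(\mathcal{B}_1(G_f)_{\mathrm{fg}})}.$$
   Context: Let $I_f\subset G_f$ be the upper triangular matrices, $I_f^1$ the unipotent upper triangular matrices, $\mathsf{H}(G_f)=R[G_f]$, and $\mathcal{B}_1(G_f)$ the block of $\mathsf{H}(G_f)$-modules containing the trivial representation $\mathbf 1$. Let $V_f=\mathbf 1\oplus\mathrm{ind}_{I_f}^{G_f}\mathbf 1$. Let $\mathcal{I}_f$ be the annihilator of $\mathrm{ind}_{I_f}^{G_f}\mathbf 1$ in $\mathsf{H}(G_f)$. For $\chi$ a nontrivial character of $I_f^1$, let $\Gamma_f=\mathrm{ind}_{I_f^1}^{G_f}\chi\oplus\mathrm{ind}_{I_f^1}^{G_f}\mathbf 1$, and let $Q_f=\Gamma_f/\mathcal{I}_f\Gamma_f$. Both $V_f$ and $Q_f$ lie in $\mathcal{B}_1(G_f)$. $D^b(\mathcal{B}_1(G_f)_{\mathrm{fg}})$ is the full subcategory of the derived category of $\mathcal{B}_1(G_f)$ of objects isomorphic to finite length complexes of finitely generated modules. For an object $X$ of a triangulated category $\mathcal{T}$, $\langle X\rangle_{\mathcal{T}}$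 is the smallest full triangulated subcategory of $\mathcal{T}$ containing $X$ and closed under isomorphisms and direct summands. *)

(* Defs.v *)
From HB Require Import structures.
From mathcomp Require Import all_boot all_order all_fingroup all_algebra.
From mathcomp Require Import boolp ring.

Set Implicit Arguments.
Unset Strict Implicit.
Unset Printing Implicit Defensive.

Import GRing.Theory.
Local Open Scope ring_scope.

Section GroupAlgebra.
Variables (gT : finGroupType) (R : comNzRingType).

(** The group algebra R[gT], under convolution. *)
Definition galg := {ffun gT -> R}.

HB.instance Definition _ := GRing.Zmodule.on galg.

Definition galg_one : galg := [ffun g => (g == 1%g)%:R].
Definition galg_mul (a b : galg) : galg :=
  [ffun g => \sum_h a h * b (h^-1 * g)%g].

Fact galg_mulA : associative galg_mul.
Proof.
move=> a b c; apply/ffunP=> g; rewrite !ffunE.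
under eq_bigr do rewrite ffunE big_distrr /=.
under [RHS]eq_bigr do rewrite ffunE big_distrl /=.
rewrite [RHS]exchange_big /=; apply: eq_bigr => h _.
rewrite [RHS](reindex_inj (mulgI h)) /=; apply: eq_bigr => x _.
by rewrite mulKg invMg mulgA mulrA.
Qed.

Fact galg_mul1 : left_id galg_one galg_mul.
Proof.
move=> a; apply/ffunP=> g; rewrite ffunE (bigD1 1%g) //= ffunE eqxx mul1r.
rewrite invg1 mul1g big1 ?addr0 // => h /negPf h1.
by rewrite ffunE h1 mul0r.
Qed.

Fact galg_mulr1 : right_id galg_one galg_mul.
Proof.
move=> a; apply/ffunP=> g; rewrite ffunE (bigD1 g) //= ffunE mulVg eqxx mulr1.
rewrite big1 ?addr0 // => h /negPf hg.
rewrite ffunE (_ : (_ == _) = false) ?mulr0 //.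
by rewrite -(inj_eq (mulgI h)) mulKVg mulg1 eq_sym.
Qed.

Fact galg_mulDl : left_distributive galg_mul +%R.
Proof.
move=> a b c; apply/ffunP=> g; rewrite !ffunE -big_split /=.
by apply: eq_bigr => h _; rewrite ffunE mulrDl.
Qed.

Fact galg_mulDr : right_distributive galg_mul +%R.
Proof.
move=> a b c; apply/ffunP=> g; rewrite !ffunE -big_split /=.
by apply: eq_bigr => h _; rewrite ffunE mulrDr.
Qed.

Fact galg_one_neq0 : galg_one != 0.
Proof.
by apply/eqP => /ffunP/(_ 1%g); rewrite !ffunE eqxx => /eqP; rewrite oner_eq0.
Qed.

HB.instance Definition _ := GRing.Zmodule_isNzRing.Build galg
  galg_mulA galg_mul1 galg_mulr1 galg_mulDl galg_mulDr galg_one_neq0.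

Record rep (V : lmodType R) := Rep {
  ract :> gT -> {linear V -> V};
  ract1 : forall v, ract 1%g v = v;
  ractM : forall g h v, ract (g * h)%g v = ract g (ract h v) }.

Definition repmod (V : lmodType R) (rho : rep V) : Type := V.

Section RepMod.
Variables (V : lmodType R) (rho : rep V).

HB.instance Definition _ := GRing.Zmodule.on (repmod rho).

Definition repmod_scale (a : galg) (v : repmod rho) : repmod rho :=
  \sum_g a g *: (rho g v : V).

Fact repmod_scaleA a b v :
  repmod_scale a (repmod_scale b v) = repmod_scale (a * b) v.
Proof.
rewrite /repmod_scale.
under eq_bigr do rewrite linear_sum scaler_sumr /=.
under [RHS]eq_bigr do rewrite ffunE scaler_suml /=.
rewrite [RHS]exchange_big /=; apply: eq_bigr => g _.
rewrite [RHS](reindex_inj (mulgI g)) /=; apply: eq_bigr => h _.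
by rewrite mulKg linearZ scalerA ractM.
Qed.

Fact repmod_scale1 : left_id 1 repmod_scale.
Proof.
move=> v; rewrite /repmod_scale (bigD1 1%g) //= ffunE eqxx scale1r ract1.
by rewrite big1 ?addr0 // => g /negPf g1; rewrite ffunE g1 scale0r.
Qed.

Fact repmod_scaleDr : right_distributive repmod_scale +%R.
Proof.
move=> a u v; rewrite /repmod_scale -big_split /=.
by apply: eq_bigr => g _; rewrite linearD scalerDr.
Qed.

Fact repmod_scaleDl v : {morph repmod_scale^~ v : a b / a + b}.
Proof.
move=> a b; rewrite /repmod_scale -big_split /=.
by apply: eq_bigr => g _; rewrite ffunE scalerDl.
Qed.

HB.instance Definition _ := GRing.Zmodule_isLmodule.Build galg (repmod rho)
  repmod_scaleA repmod_scale1 repmod_scaleDr repmod_scaleDl.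

End RepMod.

Definition triv_rep : rep R^o := @Rep R^o (fun=> idfun) (fun=> erefl) (fun _ _ _ => erefl).
Definition triv_mod : lmodType galg := repmod triv_rep.

(** Characters of H; the values outside H are irrelevant. *)
Record linchar (H : {group gT}) := LinChar {
  lchar :> gT -> R;
  lchar1 : lchar 1%g = 1;
  lcharM : {in H &, {morph lchar : x y / (x * y)%g >-> x * y}} }.

Definition linchar_one (H : {group gT}) : linchar H :=
  @LinChar H (fun=> 1) erefl (fun _ _ _ _ => esym (mulr1 1)).

Section Induction.
Variables (H : {group gT}) (chi : linchar H).

(** Functions with f (h g) = chi h * f g for h in H; below, the group acts on
    them by right translation. *)
Definition ind_pred : {pred {ffun gT -> R^o}} :=
  [pred f : {ffun gT -> R^o} |
    [forall h in H, forall g, f (h * g)%g == chi h *: f g]].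

Lemma ind_predP (f : {ffun gT -> R^o}) :
  reflect (forall h g, h \in H -> f (h * g)%g = chi h *: f g) (f \in ind_pred).
Proof.
apply: (iffP idP) => [/forall_inP Hf h g hH | Hf].
  by move/forallP: (Hf h hH) => /(_ g) /eqP.
by apply/forall_inP => h hH; apply/forallP => g; rewrite Hf.
Qed.

Fact ind_pred_submod : submod_closed ind_pred.
Proof.
split=> [|a f f' /ind_predP Hf /ind_predP Hf'].
  by apply/ind_predP => h g _; rewrite !ffunE scaler0.
apply/ind_predP => h g hH; rewrite !ffunE Hf // Hf' // scalerDr !scalerA.
by rewrite mulrC.
Qed.

HB.instance Definition _ := GRing.isSubmodClosed.Build R {ffun gT -> R^o} ind_pred
  ind_pred_submod.

Record indfun := IndFun { indval :> {ffun gT -> R^o}; _ : indval \in ind_pred }.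

HB.instance Definition _ := [isSub for indval].
HB.instance Definition _ := [Choice of indfun by <:].
HB.instance Definition _ := [SubChoice_isSubLmodule of indfun by <:].

Fact rtrans_subproof (x : gT) (f : indfun) :
  [ffun g => f (g * x)%g] \in ind_pred.
Proof.
apply/ind_predP => h g hH; rewrite !ffunE -mulgA.
by have /ind_predP-> := valP f.
Qed.

Definition rtrans (x : gT) (f : indfun) : indfun := IndFun (rtrans_subproof x f).

Fact rtrans_linear x : linear (rtrans x).
Proof. by move=> a f f'; apply/val_inj/ffunP => g /=; rewrite !ffunE. Qed.

HB.instance Definition _ x := GRing.isLinear.Build R indfun indfun _ (rtrans x)
  (rtrans_linear x).

Fact rtrans1 f : rtrans 1%g f = f.
Proof. by apply/val_inj/ffunP => g; rewrite ffunE mulg1. Qed.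

Fact rtransM x y f : rtrans (x * y)%g f = rtrans x (rtrans y f).
Proof. by apply/val_inj/ffunP => g; rewrite !ffunE mulgA. Qed.

Definition ind_rep : rep indfun := @Rep indfun rtrans rtrans1 rtransM.
Definition ind_mod : lmodType galg := repmod ind_rep.

End Induction.
End GroupAlgebra.


Section Quotient.
Variables (A : nzRingType) (M : lmodType A).

Record submodule := Submodule {
  smem :> {pred M};
  smemP : submod_closed smem }.

HB.instance Definition _ (S : submodule) :=
  GRing.isSubmodClosed.Build A M (smem S) (smemP S).

Variable S : submodule.

Definition quot_mod : Type := Quotient.quot (smem S).

HB.instance Definition _ := GRing.Zmodule.on quot_mod.

Definition quot_proj (v : M) : quot_mod := \pi_(Quotient.quot (smem S))%qT v.

Fact quot_proj_eq u v : (quot_proj u == quot_proj v) = (u - v \in smem S).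
Proof. by rewrite /quot_proj Quotient.idealrBE. Qed.

Definition quot_repr (x : quot_mod) : M := generic_quotient.repr (x : Quotient.quot (smem S)).

Fact quot_reprK : cancel quot_repr quot_proj.
Proof. exact: reprK. Qed.

Fact quot_projD : {morph quot_proj : u v / u + v}.
Proof. exact: pi_addr. Qed.

Definition quot_scale (a : A) (x : quot_mod) : quot_mod :=
  quot_proj (a *: quot_repr x).

Fact quot_scaleE a v : quot_scale a (quot_proj v) = quot_proj (a *: v).
Proof.
apply/eqP; rewrite quot_proj_eq -scalerBr rpredZ // -quot_proj_eq.
by rewrite quot_reprK.
Qed.

Fact quot_scaleA a b x : quot_scale a (quot_scale b x) = quot_scale (a * b) x.
Proof. by rewrite -[x]quot_reprK !quot_scaleE scalerA. Qed.

Fact quot_scale1 : left_id 1 quot_scale.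
Proof. by move=> x; rewrite -[x]quot_reprK quot_scaleE scale1r. Qed.

Fact quot_scaleDr : right_distributive quot_scale +%R.
Proof.
move=> a x y; rewrite -[x]quot_reprK -[y]quot_reprK -quot_projD !quot_scaleE.
by rewrite scalerDr quot_projD.
Qed.

Fact quot_scaleDl x : {morph quot_scale^~ x : a b / a + b}.
Proof.
move=> a b; rewrite -[x]quot_reprK !quot_scaleE.
by rewrite scalerDl quot_projD.
Qed.

HB.instance Definition _ := GRing.Zmodule_isLmodule.Build A quot_mod
  quot_scaleA quot_scale1 quot_scaleDr quot_scaleDl.

Fact quot_proj_linear : linear quot_proj.
Proof. by move=> a u v; rewrite quot_projD -quot_scaleE. Qed.

HB.instance Definition _ := GRing.isLinear.Build A M quot_mod _ quot_proj
  quot_proj_linear.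

End Quotient.

Section Annihilator.
Variables (A : nzRingType) (M : lmodType A).

Definition annihilator (a : A) : Prop := forall v : M, a *: v = 0.

Variable N : lmodType A.

Definition ann_smul : {pred N} := [pred x : N |
  `[< exists s : seq (A * N),
        (forall p, p \in s -> annihilator p.1) /\ x = \sum_(p <- s) p.1 *: p.2 >]].

Fact ann_smul_submod : submod_closed ann_smul.
Proof.
split=> [|a x y /asboolP[s [sI ->]] /asboolP[t [tI ->]]]; apply/asboolP.
  by exists [::]; rewrite big_nil.
exists ([seq (a * p.1, p.2) | p <- s] ++ t); split=> [p|].
  rewrite mem_cat => /orP[/mapP[r /sI rI ->] v | /tI //].
  by rewrite -scalerA rI scaler0.
rewrite big_cat big_map scaler_sumr; congr (_ + _).
by apply: eq_bigr => p _; rewrite scalerA.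
Qed.

Definition ann_submodule : submodule N := Submodule ann_smul_submod.

End Annihilator.

Definition mk_linear (A : nzRingType) (U V : lmodType A) (f : U -> V)
    (f_linear : linear f) : {linear U -> V} :=
  HB.pack f (GRing.isLinear.Build A U V *:%R f f_linear).

(** The derived category of the modules over a ring A on which e acts as the
    identity. For e a central idempotent this is a direct factor of the
    category of A-modules, equivalent to the category of eA-modules. *)
Section Derived.
Variables (A : nzRingType) (e : A).

Record blockmod := BlockMod {
  bmod :> lmodType A;
  bmodP : forall v : bmod, e *: v = v }.

Fact bprod_subproof (M N : blockmod) (v : (M * N)%type) : e *: v = v.
Proof. by case: v => x y; congr (_, _); apply: bmodP. Qed.

Definition bprod (M N : blockmod) : blockmod := BlockMod (@bprod_subproof M N).

Fact bzero_subproof (v : 'rV[A]_0) : e *: v = v.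
Proof. by rewrite [LHS]thinmx0 [RHS]thinmx0. Qed.

Definition bzero : blockmod := BlockMod bzero_subproof.

Record cochain := Cochain {
  cob :> int -> blockmod;
  cdiff : forall i, {linear cob i -> cob (i + 1)};
  cdiffK : forall i x, cdiff (i + 1) (cdiff i x) = 0 }.

Record chmap (X Y : cochain) := ChMap {
  cmap :> forall i, {linear X i -> Y i};
  cmapP : forall i x, cmap (i + 1) (cdiff X i x) = cdiff Y i (cmap i x) }.

Definition chmap_id X : chmap X X := @ChMap X X (fun=> idfun) (fun _ _ => erefl).

Fact chmap_comp_subproof X Y Z (g : chmap Y Z) (f : chmap X Y) i x :
  (g (i + 1) \o f (i + 1)) (cdiff X i x) = cdiff Z i ((g i \o f i) x).
Proof. by rewrite /= !cmapP. Qed.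

Definition chmap_comp X Y Z (g : chmap Y Z) (f : chmap X Y) : chmap X Z :=
  @ChMap X Z (fun i => g i \o f i) (@chmap_comp_subproof X Y Z g f).

(** Quasi-isomorphisms: the map induced on the cohomology in degree i + 1 is
    injective and surjective, for every integer i. *)
Definition qis X Y (f : chmap X Y) : Prop := forall i,
  (forall x : X (i + 1), cdiff X (i + 1) x = 0 ->
     (exists y, f (i + 1) x = cdiff Y i y) -> exists x', x = cdiff X i x') /\
  (forall y : Y (i + 1), cdiff Y (i + 1) y = 0 ->
     exists2 x, cdiff X (i + 1) x = 0 & exists y', f (i + 1) x = y + cdiff Y i y').

(** X[1], with X[1]^i = X^(i+1) and differential - d. *)
Fact shift_subproof (X : cochain) i (x : X (i + 1)) :
  (\- cdiff X (i + 1 + 1)) ((\- cdiff X (i + 1)) x) = 0.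
Proof. by rewrite /= linearN cdiffK oppr0 oppr0. Qed.

Definition shift (X : cochain) : cochain :=
  @Cochain (fun i => X (i + 1)) (fun i => \- cdiff X (i + 1)) (@shift_subproof X).

Fact shift_map_subproof X Y (f : chmap X Y) i (x : shift X i) :
  f (i + 1 + 1) (cdiff (shift X) i x) = cdiff (shift Y) i (f (i + 1) x).
Proof. by rewrite /= linearN cmapP. Qed.

Definition shift_map X Y (f : chmap X Y) : chmap (shift X) (shift Y) :=
  @ChMap (shift X) (shift Y) (fun i => f (i + 1)) (shift_map_subproof f).

Lemma qis_shift X Y (f : chmap X Y) : qis f -> qis (shift_map f).
Proof.
move=> qf i; have [finj fsurj] := qf (i + 1); split=> /= [x dx [y fx]|y dy].
  case: (finj x) => [||x' ->].
  - by move/eqP: dx; rewrite oppr_eq0 => /eqP.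
  - by exists (- y); rewrite linearN.
  by exists (- x'); rewrite linearN opprK.
case: (fsurj y) => [|x dx [y' fx]].
  by move/eqP: dy; rewrite oppr_eq0 => /eqP.
by exists x; [rewrite dx oppr0 | exists (- y'); rewrite linearN opprK].
Qed.

(** The mapping cone: cone(f)^i = X^(i+1) * Y^i, d (x, y) = (- d x, f x + d y). *)
Section Cone.
Variables (X Y : cochain) (f : chmap X Y).

Definition cone_ob (i : int) : blockmod := bprod (X (i + 1)) (Y i).

Definition cone_diff_fun i (v : cone_ob i) : cone_ob (i + 1) :=
  (- cdiff X (i + 1) v.1, f (i + 1) v.1 + cdiff Y i v.2).

Fact cone_diff_linear i : linear (@cone_diff_fun i).
Proof.
move=> a u v; congr (_, _); rewrite /= !linearP ?opprD ?scalerN //.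
by rewrite scalerDr addrACA.
Qed.

Fact cone_diffK i (v : cone_ob i) : cone_diff_fun (cone_diff_fun v) = 0.
Proof.
rewrite /cone_diff_fun /= [cdiff X _ _]linearN cdiffK oppr0 oppr0.
by rewrite [f _ _]linearN cmapP [cdiff Y _ (_ + _)]linearD cdiffK addr0 addNr.
Qed.

Definition cone : cochain :=
  @Cochain cone_ob (fun i => mk_linear (@cone_diff_linear i)) cone_diffK.

Definition cone_in_fun i (y : Y i) : cone i := (0, y).

Fact cone_in_linear i : linear (@cone_in_fun i).
Proof. by move=> a u v; congr (_, _); rewrite /= scaler0 addr0. Qed.

Fact cone_in_subproof i (y : Y i) :
  cone_in_fun (cdiff Y i y) = cdiff cone i (cone_in_fun y).
Proof. by congr (_, _); rewrite /= !linear0 ?oppr0 ?add0r. Qed.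

Definition cone_in : chmap Y cone :=
  @ChMap Y cone (fun i => mk_linear (@cone_in_linear i)) cone_in_subproof.

Definition cone_out_fun i (v : cone i) : shift X i := v.1.

Fact cone_out_linear i : linear (@cone_out_fun i).
Proof. by []. Qed.

Definition cone_out : chmap cone (shift X) :=
  @ChMap cone (shift X) (fun i => mk_linear (@cone_out_linear i)) (fun _ _ => erefl).

End Cone.

Section DirectSum.
Variables X Y : cochain.

Definition dsum_ob (i : int) : blockmod := bprod (X i) (Y i).

Definition dsum_diff_fun i (v : dsum_ob i) : dsum_ob (i + 1) :=
  (cdiff X i v.1, cdiff Y i v.2).

Fact dsum_diff_linear i : linear (@dsum_diff_fun i).
Proof. by move=> a u v; congr (_, _); rewrite /= linearP. Qed.

Fact dsum_diffK i (v : dsum_ob i) : dsum_diff_fun (dsum_diff_fun v) = 0.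
Proof. by congr (_, _); apply: cdiffK. Qed.

Definition dsum : cochain :=
  @Cochain dsum_ob (fun i => mk_linear (@dsum_diff_linear i)) dsum_diffK.

End DirectSum.

Section Stalk.
Variable M : blockmod.

Definition stalk_ob (i : int) : blockmod :=
  match i with Posz 0 => M | _ => bzero end.

Fact stalk_subproof i (x : stalk_ob i) :
  (\0 : {linear stalk_ob (i + 1) -> stalk_ob (i + 1 + 1)})
    ((\0 : {linear stalk_ob i -> stalk_ob (i + 1)}) x) = 0.
Proof. by []. Qed.

Definition stalk : cochain := @Cochain stalk_ob (fun=> \0) stalk_subproof.

End Stalk.

(** The derived category, as the localization of the category of complexes at
    the quasi-isomorphisms: its morphisms are formal composites of chain maps
    and of inverses of quasi-isomorphisms, modulo the congruence [deq]. *)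
Inductive dhom : cochain -> cochain -> Type :=
| dmap X Y : chmap X Y -> dhom X Y
| dinv X Y (s : chmap X Y) : qis s -> dhom Y X
| dcomp X Y Z : dhom Y Z -> dhom X Y -> dhom X Z.

Inductive deq : forall X Y, dhom X Y -> dhom X Y -> Prop :=
| deq_refl X Y (f : dhom X Y) : deq f f
| deq_sym X Y (f g : dhom X Y) : deq f g -> deq g f
| deq_trans X Y (f g h : dhom X Y) : deq f g -> deq g h -> deq f h
| deq_comp X Y Z (g g' : dhom Y Z) (f f' : dhom X Y) :
    deq g g' -> deq f f' -> deq (dcomp g f) (dcomp g' f')
| deq_compA X Y Z T (h : dhom Z T) (g : dhom Y Z) (f : dhom X Y) :
    deq (dcomp h (dcomp g f)) (dcomp (dcomp h g) f)
| deq_idl X Y (f : dhom X Y) : deq (dcomp (dmap (chmap_id Y)) f) f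
| deq_idr X Y (f : dhom X Y) : deq (dcomp f (dmap (chmap_id X))) f
| deq_map X Y (f g : chmap X Y) : (forall i, f i =1 g i) -> deq (dmap f) (dmap g)
| deq_map_comp X Y Z (g : chmap Y Z) (f : chmap X Y) :
    deq (dmap (chmap_comp g f)) (dcomp (dmap g) (dmap f))
| deq_invl X Y (s : chmap X Y) (hs : qis s) :
    deq (dcomp (dinv hs) (dmap s)) (dmap (chmap_id X))
| deq_invr X Y (s : chmap X Y) (hs : qis s) :
    deq (dcomp (dmap s) (dinv hs)) (dmap (chmap_id Y)).

Fixpoint dshift X Y (f : dhom X Y) : dhom (shift X) (shift Y) :=
  match f with
  | dmap _ _ f => dmap (shift_map f)
  | dinv _ _ _ hs => dinv (qis_shift hs)
  | dcomp _ _ _ g f => dcomp (dshift g) (dshift f)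
  end.

Definition diso X Y (f : dhom X Y) : Prop :=
  exists g : dhom Y X, deq (dcomp g f) (dmap (chmap_id X)) /\
                       deq (dcomp f g) (dmap (chmap_id Y)).

Definition disomorphic X Y : Prop := exists f : dhom X Y, diso f.

(** Distinguished triangles are the triangles isomorphic, in the derived
    category, to the triangle A -> B -> cone f -> A[1] of a chain map f. *)
Definition distinguished X Y Z (u : dhom X Y) (v : dhom Y Z)
    (w : dhom Z (shift X)) : Prop :=
  exists X' Y' (f : chmap X' Y')
    (a : dhom X X') (b : dhom Y Y') (c : dhom Z (cone f)),
    [/\ diso a, diso b & diso c] /\
    [/\ deq (dcomp b u) (dcomp (dmap f) a),
        deq (dcomp c v) (dcomp (dmap (cone_in f)) b) &
        deq (dcomp (dshift a) w) (dcomp (dmap (cone_out f)) c)].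

Definition fingen (M : lmodType A) : Prop :=
  exists n (s : 'I_n -> M), forall v, exists c : 'I_n -> A, v = \sum_i c i *: s i.

Definition bounded (X : cochain) : Prop :=
  exists n : nat, forall i : int, (n < `|i|)%N -> forall x : X i, x = 0.

Definition Db_fg (X : cochain) : Prop :=
  exists2 Y, bounded Y /\ (forall i, fingen (Y i)) & disomorphic X Y.

Record dbcat := DbCat { dbob :> cochain; dbobP : Db_fg dbob }.

(** Full triangulated subcategories of the bounded derived category, closed
    under isomorphisms and direct summands, given by their objects. *)
Record thick (P : dbcat -> Prop) : Prop := Thick {
  thick_iso : forall X Y : dbcat, disomorphic X Y -> P X -> P Y;
  (* both directions: closure under [1] and [-1] *)
  thick_shift : forall X Y : dbcat, disomorphic Y (shift X) -> P X <-> P Y;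
  thick_cone : forall (X Y Z : dbcat) (u : dhom X Y) (v : dhom Y Z)
      (w : dhom Z (shift X)), distinguished u v w -> P X -> P Y -> P Z;
  thick_summand : forall X Y Z : dbcat, disomorphic X (dsum Y Z) -> P X -> P Y }.

Definition thick_closure (X Y : dbcat) : Prop :=
  forall P : dbcat -> Prop, thick P -> P X -> P Y.

Lemma stalk_Db_fg (M : blockmod) : fingen M -> Db_fg (stalk M).
Proof.
move=> Mfg; exists (stalk M).
  split=> [|i].
    by exists 0%N => -[[|n]|n] //= _ x; rewrite [LHS]thinmx0 [RHS]thinmx0.
  have bzero_fg : fingen bzero.
    exists 0%N, (fun=> 0) => v; exists (fun=> 0).
    by rewrite [LHS]thinmx0 [RHS]thinmx0.
  by case: i => [[|n]|n].
by exists (dmap (chmap_id _)), (dmap (chmap_id _)); split; apply: deq_idl.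
Qed.

Definition db_stalk (M : blockmod) (Mfg : fingen M) : dbcat :=
  DbCat (stalk_Db_fg Mfg).

End Derived.

(** Blocks correspond to the minimal nonzero central idempotents. *)
Definition central_idem (A : nzRingType) (e : A) : Prop :=
  e * e = e /\ forall a, e * a = a * e.

Definition block_idem (A : nzRingType) (e : A) : Prop :=
  [/\ central_idem e, e != 0 &
      forall f, central_idem f -> f * e = f -> f = 0 \/ f = e].

Section PrincipalBlock.
Variables (gT : finGroupType) (R : fieldType).
Local Notation A := (galg gT R).
Local Notation triv := (triv_mod gT R).

Definition principal_idem (e : A) : Prop :=
  block_idem e /\ forall v : triv, e *: v = v.

Lemma triv_scaleE (a : A) (v : triv) : a *: v = (\sum_g a g) * (v : R).
Proof. by rewrite mulr_suml. Qed.

Let aug (a : A) : R := \sum_g a g.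

Let augM : {morph aug : a b / a * b}.
Proof.
move=> a b; apply/esym; have := scalerA a b (1 : triv).
by rewrite !triv_scaleE !mulr1.
Qed.

Let augB : {morph aug : a b / a - b}.
Proof.
by move=> a b; rewrite /aug -sumrB; apply: eq_bigr => g _; rewrite !ffunE.
Qed.

Let lmul (e : A) (a : {ffun gT -> R^o}) : {ffun gT -> R^o} := e * (a : A).

Let lmul_linear e : linear (lmul e).
Proof.
move=> c a b; apply/ffunP => g; rewrite !ffunE scaler_sumr -big_split /=.
by apply: eq_bigr => h _; rewrite !ffunE mulrDr mulrCA.
Qed.

Let rk (e : A) : nat :=
  \dim (limg (linfun (mk_linear (@lmul_linear e)))).

Let rk_lt (e f : A) : central_idem e -> central_idem f -> f * e = f ->
  f != e -> (rk f < rk e)%N.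
Proof.
move=> [ee ec] [ff fc] fe f_neq_e; rewrite /rk.
set Lf := linfun _; set Le := linfun _.
have LfE a : Lf a = f * (a : A) by rewrite lfunE.
have LeE a : Le a = e * (a : A) by rewrite lfunE.
have sub : (limg Lf <= limg Le)%VS.
  apply/subvP => _ /memv_imgP[a _ ->].
  have -> : Lf a = Le (Lf a) by rewrite LeE !LfE mulrA -fc fe.
  exact: memv_img (memvf _).
rewrite ltn_neqAle (dimv_leqif_eq sub) dimvS // andbT.
apply: contra f_neq_e => /eqP eq_img.
have : (Le (e : A) : {ffun gT -> R^o}) \in limg Le by apply: memv_img (memvf _).
rewrite -eq_img => /memv_imgP[a _].
rewrite LeE LfE ee => ea; apply/eqP; rewrite -[LHS]fe.
by rewrite [in LHS]ea mulrA ff -ea.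
Qed.

Lemma principal_idem_exists : exists e : A, principal_idem e.
Proof.
pose nice (e : A) := central_idem e /\ aug e = 1.
have nice_triv e : nice e -> forall v : triv, e *: v = v.
  by case=> _ e1 v; rewrite triv_scaleE -/(aug e) e1 mul1r.
have aug1 : aug 1 = 1.
  by have := scale1r (1 : triv); rewrite triv_scaleE mulr1.
have nice1 : nice 1 by split=> //; split=> [|a]; rewrite ?mul1r ?mulr1.
suff main n : forall e, nice e -> (rk e < n)%N -> exists e : A, principal_idem e.
  exact: main nice1 (ltnSn _).
elim: n => // n IHn e [ce e1] rke.
have [ee ec] := ce.
have [[f [[cf fe] f0 fNe]]|noF] := pselect (exists f : A,
    [/\ central_idem f /\ f * e = f, f != 0 & f != e]); last first.
  exists e; split; last exact: nice_triv.
  split=> // [|f cf fe].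
    apply: contraTneq isT => e0; move/eqP: e1; rewrite e0 /aug big1 => [|g _].
      by rewrite eq_sym oner_eq0.
    by rewrite ffunE.
  have [->|f0] := eqVneq f 0; first by left.
  have [->|fNe] := eqVneq f e; first by right.
  by case: noF; exists f.
have [ff fc] := cf.
have /eqP : aug f * (aug f - 1) = 0 by rewrite mulrBr mulr1 -augM ff subrr.
rewrite mulf_eq0 subr_eq0 => /orP[/eqP f1|/eqP f1]; last first.
  apply: (IHn f); first by split.
  exact: leq_trans (rk_lt ce cf fe fNe) rke.
have ef : e * f = f by rewrite ec.
have cef : central_idem (e - f).
  split=> [|a]; last by rewrite mulrBl mulrBr ec fc.
  by rewrite mulrBl !mulrBr ee fe ef ff subrr subr0.
apply: (IHn (e - f)); first by split=> //; rewrite augB e1 f1 subr0.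
apply: leq_trans (rk_lt ce cef _ _) rke; first by rewrite mulrBl ee fe.
by rewrite -subr_eq0 addrAC subrr add0r oppr_eq0.
Qed.

Lemma principal_idem_unique (e f : A) :
  principal_idem e -> principal_idem f -> e = f.
Proof.
move=> [[[ee ec] _ emin] e1] [[[ff fc] _ fmin] f1].
have cef : central_idem (e * f).
  split=> [|a]; first by rewrite mulrA -[e * f * e]mulrA -ec mulrA ee -mulrA ff.
  by rewrite -mulrA fc mulrA ec mulrA.
have ef0 : e * f <> 0.
  move=> ef0; have := scalerA e f (1 : triv); rewrite f1 e1 ef0 scale0r.
  by move/eqP; rewrite oner_eq0.
case: (emin _ cef) => // [|<-]; first by rewrite -mulrA -ec mulrA ee.
by case: (fmin _ cef) => //; rewrite -mulrA ff.
Qed.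

(** The modules in the block containing the trivial representation are those
    on which this idempotent acts as the identity. *)
Definition block1_idem : A := sval (cid principal_idem_exists).

Lemma block1_idemP : principal_idem block1_idem.
Proof. exact: (svalP (cid principal_idem_exists)). Qed.

End PrincipalBlock.
Arguments block1_idem : clear implicits.

Section FinGen.
Variables (A : nzRingType).

Lemma fingen_prod (M N : lmodType A) :
  fingen M -> fingen N -> fingen (M * N)%type.
Proof.
move=> [m [s Ms]] [n [t Nt]].
exists (m + n)%N, (fun i => match split i with inl j => (s j, 0) | inr j => (0, t j) end).
move=> [x y]; have [c ->] := Ms x; have [d ->] := Nt y.
exists (fun i => match split i with inl j => c j | inr j => d j end).
rewrite big_split_ord /=.
under [X in _ = X + _]eq_bigr => i _ do
  rewrite -[lshift n i]/(unsplit (inl i)) unsplitK.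
under [X in _ = _ + X]eq_bigr => i _ do
  rewrite -[rshift m i]/(unsplit (inr i)) unsplitK.
have sum_pair (p : nat) (f : 'I_p -> M) (g : 'I_p -> N) :
  \sum_i (f i, g i) = (\sum_i f i, \sum_i g i).
  by rewrite [LHS]surjective_pairing (raddf_sum fst) (raddf_sum snd).
rewrite [X in _ = X + _](sum_pair _ (fun i => c i *: s i) (fun i => c i *: 0)).
rewrite [X in _ = _ + X](sum_pair _ (fun i => d i *: 0) (fun i => d i *: t i)).
congr (_, _) => /=.
  by rewrite [X in _ + X]big1 ?addr0 // => i _; rewrite scaler0.
by rewrite [X in X + _]big1 ?add0r // => i _; rewrite scaler0.
Qed.

Lemma fingen_quot (M : lmodType A) (S : submodule M) :
  fingen M -> fingen (quot_mod S).
Proof.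
move=> [n [s Ms]]; exists n, (fun i => quot_proj S (s i)) => x.
have [c cx] := Ms (quot_repr x); exists c.
by rewrite -[LHS]quot_reprK cx linear_sum; apply: eq_bigr => i _; rewrite linearZ.
Qed.

Lemma fingen_cyclic (M : lmodType A) (x : M) :
  (forall v, exists a, v = a *: x) -> fingen M.
Proof.
move=> Mx; exists 1%N, (fun=> x) => v; have [a ->] := Mx v.
by exists (fun=> a); rewrite big_ord1.
Qed.

End FinGen.

Section IndFacts.
Variables (gT : finGroupType) (R : fieldType) (H : {group gT}).
Variable chi : linchar R H.
Local Notation A := (galg gT R).
Local Notation Ind := (ind_mod chi).

Lemma ind_scaleE (a : A) (f : Ind) g :
  (a *: f : indfun chi) g = \sum_x a x * (f : indfun chi) (g * x)%g.
Proof.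
rewrite (big_morph (fun f : indfun chi => f g) (id1 := 0) (op1 := +%R)).
- by apply: eq_bigr => x _; rewrite /= !ffunE.
- by move=> u v /=; rewrite !ffunE.
- by rewrite /= ffunE.
Qed.

Fact ind_gen_subproof :
  [ffun g => if g \in H then chi g else 0 : R^o] \in ind_pred chi.
Proof.
apply/ind_predP => h g hH; rewrite !ffunE groupMl //.
by case: ifP => gH; rewrite ?scaler0 // lcharM.
Qed.

Definition ind_gen : Ind := IndFun ind_gen_subproof.

Lemma ind_genP (f : Ind) : exists a : A, f = a *: ind_gen.
Proof.
pose F : {ffun gT -> R^o} := indval f.
exists [ffun y => if repr (H :* y^-1)%g == y^-1%g then F y^-1%g else 0].
apply/val_inj/ffunP => g; rewrite [RHS]ind_scaleE (reindex_inj invg_inj) /=.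
pose x := repr (H :* g)%g; have xHg : x \in (H :* g)%g by apply: mem_repr (rcoset_refl _ _).
have Hgx : (g * x^-1)%g \in H by rewrite -mem_rcoset rcoset_sym.
rewrite (bigD1 x) //= big1 => [|y /negPf yx].
  rewrite !ffunE invgK (rcoset_eqP xHg) eqxx Hgx addr0 mulrC.
  have /ind_predP/(_ _ x Hgx) := valP (f : indfun chi).
  by rewrite mulgKV.
rewrite !ffunE invgK; case: ifP => [/eqP yr|]; last by rewrite mul0r.
case: ifP; last by rewrite mulr0.
rewrite -mem_rcoset => gy; case/eqP: yx.
by rewrite /x (rcoset_eqP gy) yr.
Qed.

Lemma ind_fg : fingen Ind.
Proof. exact: fingen_cyclic ind_genP. Qed.

End IndFacts.

Lemma triv_fg (gT : finGroupType) (R : fieldType) : fingen (triv_mod gT R).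
Proof.
apply: (@fingen_cyclic _ (triv_mod gT R) (1 : R)) => v.
exists [ffun g => if g == 1%g then v : R else 0].
rewrite triv_scaleE mulr1 (bigD1 1%g) //= big1 ?ffunE ?eqxx ?addr0 // => g /negPf g1.
by rewrite ffunE g1.
Qed.

Section GL2.
Variable k : finFieldType.
Local Notation G := {'GL_2[k]}.
Local Notation mx u := (GLval u : 'M[k]_2).

Definition borel_set : {set G} := [set u : G | mx u 1 0 == 0].

Lemma GL2_ME (u v : G) i j :
  mx (u * v)%g i j = mx u i 0 * mx v 0 j + mx u i 1 * mx v 1 j.
Proof.
by rewrite GL_MxE mxE big_ord_recl big_ord1; congr (_ + mx u i _ * mx v _ j);
  apply/val_inj.
Qed.

Lemma GL2_1E i j : mx (1%g : G) i j = (i == j)%:R.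
Proof. by rewrite GL_1E mxE. Qed.

Fact borel_group_set : group_set borel_set.
Proof.
apply/group_setP; split=> [|u v]; first by rewrite inE GL2_1E.
by rewrite !inE => /eqP u0 /eqP v0; rewrite GL2_ME u0 v0 mul0r mulr0 addr0.
Qed.

Definition borel : {group G} := Group borel_group_set.

Definition unip_set : {set G} :=
  [set u : G | [&& mx u 1 0 == 0, mx u 0 0 == 1 & mx u 1 1 == 1]].

Fact unip_group_set : group_set unip_set.
Proof.
apply/group_setP; split=> [|u v]; first by rewrite inE !GL2_1E !eqxx.
rewrite !inE => /and3P[/eqP u0 /eqP u1 /eqP u2] /and3P[/eqP v0 /eqP v1 /eqP v2].
by rewrite !GL2_ME u0 u1 u2 v0 v1 v2 !(mul0r, mulr0, mul1r, addr0, add0r) !eqxx.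
Qed.

Definition unip : {group G} := Group unip_group_set.

Lemma GL2_det (u : G) : mx u 0 0 * mx u 1 1 - mx u 0 1 * mx u 1 0 != 0.
Proof.
have := GL_det u; rewrite (expand_det_row _ 0) big_ord_recl big_ord1 /cofactor.
rewrite !det_mx11 !mxE /= expr0 expr1 mul1r mulN1r mulrN.
congr (_ - _ != 0); congr (mx u _ _ * mx u _ _); exact/val_inj.
Qed.

Definition mx2 (a b c d : k) : 'M[k]_2 :=
  \matrix_(i, j) (if i == 0 then if j == 0 then a else b
                  else if j == 0 then c else d).

Lemma mx2_unit a b c d : a * d - b * c != 0 -> mx2 a b c d \is a GRing.unit.
Proof.
move=> nz; rewrite [_ \is a _]unitmxE unitfE.
rewrite (expand_det_row _ 0) big_ord_recl big_ord1 /cofactor.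
by rewrite !det_mx11 !mxE /= expr0 expr1 mul1r mulN1r mulrN.
Qed.

Definition GL2 a b c d (nz : a * d - b * c != 0) : G := FinRing.Unit (mx2_unit nz).

Lemma GL2_eqP (u v : G) :
  [/\ mx u 0 0 = mx v 0 0, mx u 0 1 = mx v 0 1,
      mx u 1 0 = mx v 1 0 & mx u 1 1 = mx v 1 1] -> u = v.
Proof.
case=> e00 e01 e10 e11; apply/val_inj/matrixP => i j.
have ord2 (x : 'I_2) : x = 0 \/ x = 1.
  by case: x => [[|[|?]] ?] //; [left | right]; apply/val_inj.
by case: (ord2 i) => ->; case: (ord2 j) => ->.
Qed.

Lemma bruhat_nz_w : 0 * 0 - 1 * 1 != 0 :> k.
Proof. by rewrite mul0r mul1r sub0r oppr_eq0 oner_eq0. Qed.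

Lemma bruhat (g : G) : g \notin borel ->
  exists b b', [/\ b \in borel, b' \in borel & g = (b * GL2 bruhat_nz_w * b')%g].
Proof.
rewrite inE => c0; set c := mx g 1 0 in c0.
have D0 := GL2_det g; set D := _ - _ in D0.
have nz1 : (- D / c) * 1 - (mx g 0 0 / c) * 0 != 0.
  by rewrite mulr1 mulr0 subr0 mulf_neq0 ?oppr_eq0 ?invr_eq0.
have nz2 : c * 1 - mx g 1 1 * 0 != 0 by rewrite mulr1 mulr0 subr0.
exists (GL2 nz1), (GL2 nz2); split; rewrite ?inE ?mxE //.
apply: GL2_eqP; rewrite !GL2_ME !mxE /= /D -/c; split; by field.
Qed.

Lemma card_borel : #|borel| = (#|k| * #|k|.-1 ^ 2)%N.
Proof.
pose phi (u : G) := (mx u 0 0, mx u 1 1, mx u 0 1).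
rewrite -(card_in_imset (f := phi)) => [|u v].
  have -> : phi @: borel = setX (setX [set~ 0] [set~ 0]) setT.
    apply/setP=> -[[a d] b]; rewrite !inE andbT /=.
    apply/imsetP/andP => [[u] | [a0 d0]].
      rewrite inE => /eqP u0 [-> -> _]; have := GL2_det u.
      by rewrite u0 mulr0 subr0 mulf_eq0 negb_or => /andP[].
    have nz : a * d - b * 0 != 0 by rewrite mulr0 subr0 mulf_neq0.
    by exists (GL2 nz); rewrite ?inE /phi !mxE.
  by rewrite !cardsX cardsT !cardsC1 mulnC mulnn.
rewrite !inE => /eqP u0 /eqP v0 [e00 e11 e01]; apply: GL2_eqP.
by rewrite u0 v0.
Qed.

Section Modules.
Variables (R : fieldType).
Local Notation A := (galg G R).

Definition ind_borel : lmodType A := ind_mod (linchar_one R borel).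

Definition V_mod : lmodType A := (triv_mod G R * ind_borel)%type.

Variable chi : linchar R unip.

Definition Gamma_mod : lmodType A :=
  (ind_mod chi * ind_mod (linchar_one R unip))%type.

(** ann_submodule M N is the submodule I N of N, for I the annihilator of M. *)
Definition Q_mod : lmodType A := quot_mod (ann_submodule ind_borel Gamma_mod).

Lemma V_fg : fingen V_mod.
Proof. by apply: fingen_prod; [apply: triv_fg | apply: ind_fg]. Qed.

Lemma Q_fg : fingen Q_mod.
Proof. by apply/fingen_quot/fingen_prod; apply: ind_fg. Qed.

Section InBlock.
Variable l : nat.
Hypotheses (charRl : l \in [pchar R]) (odd_l : odd l) (l_dvd : (l %| #|k|.+1)%N).

Let q1 : #|k|.+1%:R = 0 :> R.
Proof. by apply/eqP; rewrite -(dvdn_pcharf charRl). Qed.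

Let two0 : 2%:R != 0 :> R.
Proof.
rewrite -(dvdn_pcharf charRl); apply/negP => /dvdn_leq l2.
have lE : l = 2%N.
  by apply/eqP; rewrite eqn_leq l2 // prime_gt1 // (pcharf_prime charRl).
by move: odd_l; rewrite lE.
Qed.

Let borel0 : #|borel|%:R != 0 :> R.
Proof.
have q0 : (0 < #|k|)%N by apply/card_gt0P; exists 0.
have qE : #|k|%:R = - 1 :> R by apply/eqP; rewrite -addr_eq0 natr1 q1.
rewrite card_borel natrM natrX -subn1 natrB // qE.
rewrite mulf_neq0 ?oppr_eq0 ?oner_eq0 // expf_neq0 //.
by rewrite -opprD oppr_eq0 -(natrD _ 1 1).
Qed.

Lemma block1_ind_borel (v : ind_borel) : block1_idem G R *: v = v.
Proof.
set e := block1_idem G R; have [[[ee ec] _ _] e_triv] := block1_idemP G R.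
rewrite -/e in ee ec e_triv.
pose phi : ind_borel := ind_gen (linchar_one R borel).
have phiE g : (phi : indfun _) g = (g \in borel)%:R.
  by rewrite /= !ffunE; case: ifP.
have sum_e : \sum_x e x = 1.
  by have := e_triv (1 : R); rewrite triv_scaleE mulr1.
pose F : indfun (linchar_one R borel) := e *: phi.
have Fl b g : b \in borel -> F (b * g)%g = F g.
  by move=> bB; have /ind_predP-> := valP F; rewrite ?scale1r.
have Fr b g : b \in borel -> F (g * b)%g = F g.
  move=> bB; pose d : A := [ffun x => (x == b)%:R].
  have dE (f : ind_borel) h : (d *: f : indfun _) h = (f : indfun _) (h * b)%g.
    rewrite ind_scaleE (bigD1 b) //= big1 => [|x /negPf xb].
      by rewrite ffunE eqxx mul1r addr0.
    by rewrite ffunE xb mul0r.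
  have dphi : d *: phi = phi.
    by apply/val_inj/ffunP => h; rewrite [LHS]dE !phiE groupMr.
  by rewrite -dE /F scalerA -ec -scalerA dphi.
pose c := F (GL2 bruhat_nz_w); pose a := F 1%g - c.
have FE g : F g = a * (g \in borel)%:R + c.
  case: (boolP (g \in borel)) => [gB|/bruhat[b [b' [bB b'B ->]]]].
    by rewrite mulr1 subrK -[g]mulg1 Fl.
  by rewrite mulr0 add0r Fr // Fl.
have Fsum : \sum_g F g = #|borel|%:R.
  rewrite /F; under eq_bigr do rewrite ind_scaleE.
  rewrite exchange_big /= (eq_bigr (fun x => e x * #|borel|%:R)) => [|x _].
    by rewrite -mulr_suml sum_e mul1r.
  rewrite -mulr_sumr; congr (_ * _); rewrite -sum1_card natr_sum [RHS]big_mkcond /=.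
  rewrite [RHS](reindex_inj (mulIg x)) /=; apply: eq_bigr => g _.
  by rewrite [LHS]phiE; case: (_ \in _).
have G0 : #|{: G}|%:R = 0 :> R.
  by rewrite -cardsT (card_GL_2 k) natrM q1 mulr0.
have a1 : a = 1.
  apply/eqP; rewrite -(inj_eq (mulIf borel0)) mul1r -{2}Fsum.
  under eq_bigr do rewrite FE.
  rewrite big_split /= sumr_const -[c *+ _]mulr_natr G0 mulr0 addr0 -mulr_sumr.
  apply/eqP; congr (_ * _); rewrite -sum1_card natr_sum [LHS]big_mkcond /=.
  by apply: eq_bigr => g _; case: ifP.
have c0 : c = 0.
  have Fw := ind_scaleE e phi (GL2 bruhat_nz_w).
  have eF : e *: (F : ind_borel) = F by rewrite scalerA ee.
  have /= := congr1 (fun f : indfun _ => f (GL2 bruhat_nz_w)) eF.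
  rewrite ind_scaleE; under eq_bigr do rewrite FE a1 mul1r mulrDr -phiE.
  rewrite big_split /= -mulr_suml sum_e mul1r -[X in X + _]Fw -/F -/c.
  by move/eqP; rewrite -subr_eq0 addrK => /eqP.
have Fphi : e *: phi = phi.
  by apply/val_inj/ffunP => g; rewrite phiE [LHS]FE a1 c0 mul1r addr0.
have [b ->] := ind_genP v.
by rewrite scalerA ec -scalerA Fphi.
Qed.

Lemma V_block (v : V_mod) : block1_idem G R *: v = v.
Proof.
case: v => x y; congr (_, _); last exact: block1_ind_borel.
by have [_ ->] := block1_idemP G R.
Qed.

Lemma Q_block (x : Q_mod) : block1_idem G R *: x = x.
Proof.
rewrite -[x]quot_reprK -linearZ; apply/eqP; rewrite quot_proj_eq; apply/asboolP.
set v := quot_repr x; exists [:: (block1_idem G R - 1, v)]; split=> [p|].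
  rewrite inE => /eqP-> w.
  by rewrite /= scalerBl scale1r block1_ind_borel subrr.
by rewrite big_seq1 /= scalerBl scale1r.
Qed.

Definition V_ob : dbcat (block1_idem G R) := @db_stalk _ _ (BlockMod V_block) V_fg.

Definition Q_ob : dbcat (block1_idem G R) := @db_stalk _ _ (BlockMod Q_block) Q_fg.

End InBlock.
End Modules.
End GL2.

(* Main.v *)
Require Import Defs.
From mathcomp Require Import all_boot all_order all_fingroup all_algebra.
From mathcomp Require Import boolp zify ring.

(** Write P for the module induced from the trivial character of the Borel
    subgroup B, i.e. the functions on the projective line, and I for its
    annihilator. As q = -1 and 2 <> 0 in R, the order of B is invertible in R.
    For a nontrivial chi, the chi-equivariant vectors of P form a line; by
    Frobenius reciprocity a generator w of it defines a map from Ind chi to P,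
    whose kernel is exactly I Ind chi, because every element of P is sent into
    the line of w by the chi-isotypic projector. Averaging w over the torus shows
    that its image W is the kernel of the augmentation P -> 1. In the same way,
    Ind 1 / I Ind 1 = P, since the unipotent invariants of P are invariant under
    B. Hence Q = W + P and V = 1 + P, and the triangle W -> P -> 1 shows that Q
    and V lie in the same thick subcategories. *)

Set Implicit Arguments.
Unset Strict Implicit.
Unset Printing Implicit Defensive.

Import GRing.Theory.
Local Open Scope ring_scope.

(** * Thick subcategories *)

Section Isomorphisms.
Variables (A : nzRingType) (e : A).
Implicit Types X Y Z : cochain e.

Lemma deq_cancell X Y Z (s : dhom Y Z) (s' : dhom Z Y) (f : dhom X Y) :
  deq (dcomp s' s) (dmap (chmap_id Y)) -> deq (dcomp s' (dcomp s f)) f.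
Proof.
move=> s's; apply: deq_trans (deq_compA _ _ _) _.
exact: deq_trans (deq_comp s's (deq_refl f)) (deq_idl f).
Qed.

Lemma disomorphic_refl X : disomorphic X X.
Proof.
by exists (dmap (chmap_id X)), (dmap (chmap_id X)); split; apply: deq_idl.
Qed.

Lemma disomorphic_sym X Y : disomorphic X Y -> disomorphic Y X.
Proof. by case=> f [g [gf fg]]; exists g, f. Qed.

Lemma disomorphic_trans X Y Z :
  disomorphic X Y -> disomorphic Y Z -> disomorphic X Z.
Proof.
move=> [f [f' [f'f ff']]] [g [g' [g'g gg']]].
exists (dcomp g f), (dcomp f' g'); split.
  apply: deq_trans (deq_sym (deq_compA _ _ _)) _.
  exact: deq_trans (deq_comp (deq_refl _) (deq_cancell f g'g)) f'f.
apply: deq_trans (deq_sym (deq_compA _ _ _)) _.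
exact: deq_trans (deq_comp (deq_refl _) (deq_cancell g' ff')) gg'.
Qed.

Lemma diso_id X : diso (dmap (chmap_id X)).
Proof. by exists (dmap (chmap_id X)); split; apply: deq_idl. Qed.

Lemma diso_inv X Y (s : chmap X Y) (hs : qis s) : diso (dinv hs).
Proof. by exists (dmap s); split; [apply: deq_invr | apply: deq_invl]. Qed.

Lemma qis_disomorphic X Y (s : chmap X Y) : qis s -> disomorphic X Y.
Proof.
by move=> hs; exists (dmap s), (dinv hs); split; [apply: deq_invl | apply: deq_invr].
Qed.

Lemma qis_bij X Y (s : chmap X Y) :
  (forall i, injective (s i)) -> (forall i y, exists x, s i x = y) -> qis s.
Proof.
move=> s_inj s_surj i; split=> [x _ [y sxy] | y dy0].
  have [x' sx'] := s_surj i y; exists x'; apply: s_inj.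
  by rewrite sxy -sx' cmapP.
have [x sx] := s_surj _ y; exists x; last by exists 0; rewrite linear0 addr0.
by apply: s_inj; rewrite cmapP sx dy0 linear0.
Qed.

(** Checked on each generating relation of the congruence; this is what makes the shift a functor on
    the derived category, so that it preserves isomorphisms. *)
Lemma dshift_deq X Y (f g : dhom X Y) : deq f g -> deq (dshift f) (dshift g).
Proof.
elim=> {X Y f g} /=.
- by move=> *; apply: deq_refl.
- by move=> *; apply: deq_sym.
- by move=> *; apply: deq_trans; eassumption.
- by move=> *; apply: deq_comp.
- by move=> *; apply: deq_compA.
- move=> X Y f; apply: deq_trans (deq_idl _).
  by apply: deq_comp (deq_refl _); apply: deq_map.
- move=> X Y f; apply: deq_trans (deq_idr _).
  by apply: deq_comp (deq_refl _) _; apply: deq_map.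
- by move=> X Y f g fg; apply: deq_map => i; apply: fg.
- move=> X Y Z g f; apply: deq_trans (deq_map_comp _ _).
  by apply: deq_map.
- move=> X Y s hs; apply: deq_trans (deq_invl _) _; exact: deq_map.
- move=> X Y s hs; apply: deq_trans (deq_invr _) _; exact: deq_map.
Qed.

Lemma disomorphic_shift X Y : disomorphic X Y -> disomorphic (shift X) (shift Y).
Proof.
have shift_id Z : deq (dmap (shift_map (chmap_id Z))) (dmap (chmap_id (shift Z))).
  exact: deq_map.
case=> f [g [gf fg]]; exists (dshift f), (dshift g); split.
  exact: deq_trans (dshift_deq gf) (shift_id X).
exact: deq_trans (dshift_deq fg) (shift_id Y).
Qed.

Lemma Db_fg_shift X : Db_fg X -> Db_fg (shift X).
Proof.
case=> Y [[n Yn] Yfg] XY; exists (shift Y); last exact: disomorphic_shift.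
split=> [|i]; last exact: Yfg.
(* Degree [i] of the shift is degree [i + 1] of [Y], so the bound grows by one. *)
by exists n.+1 => i ni; apply: Yn; lia.
Qed.

Definition dbshift (X : dbcat e) : dbcat e := DbCat (Db_fg_shift (dbobP X)).

End Isomorphisms.

(** * Short exact sequences of complexes and mapping cones *)

Section ShortExactSequences.
Variables (A : nzRingType) (e : A) (X Y Z : cochain e).
Variables (f : chmap X Y) (g : chmap Y Z).
Hypothesis f_inj : forall i, injective (f i).
Hypothesis g_surj : forall i z, exists y, g i y = z.
Hypothesis gf0 : forall i x, g i (f i x) = 0.
Hypothesis fg_exact : forall i y, g i y = 0 -> exists x, y = f i x.

Definition cone_to_quo_fun i (v : cone f i) : Z i := g i v.2.

Fact cone_to_quo_linear i : linear (@cone_to_quo_fun i).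
Proof. by move=> a u v; rewrite /cone_to_quo_fun /= linearP. Qed.

Fact cone_to_quo_chain i (v : cone f i) :
  cone_to_quo_fun (cdiff (cone f) i v) = cdiff Z i (cone_to_quo_fun v).
Proof. by rewrite /cone_to_quo_fun /= linearD gf0 add0r cmapP. Qed.

Definition cone_to_quo : chmap (cone f) Z :=
  @ChMap _ _ (cone f) Z (fun i => mk_linear (@cone_to_quo_linear i)) cone_to_quo_chain.

(** The cone of a monomorphism computes its cokernel: lifts along [g] are corrected by elements of
    the image of [f], and the [X]-component is then forced by the injectivity of [f]. *)
Lemma qis_cone_to_quo : qis cone_to_quo.
Proof.
move=> i; split=> [[x y] /= [dx fxdy] [z gyz] | z dz].
  have [y' y'z] := g_surj z.
  have /fg_exact[x' yx'] : g (i + 1) (y - cdiff Y i y') = 0.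
    by rewrite linearB cmapP y'z -gyz subrr.
  exists (x', y'); congr (_, _); last by rewrite -yx' subrK.
  apply: f_inj; rewrite linearN cmapP -yx' linearB cdiffK subr0.
  by apply/eqP; rewrite -addr_eq0 fxdy.
have [y gyz] := g_surj z.
have /fg_exact[x dyx] : g (i + 1 + 1) (cdiff Y (i + 1) y) = 0.
  by rewrite cmapP gyz.
(* The sign cancels [f x = d y] in the second component of the differential of the cone. *)
exists (- x, y); last by exists 0; rewrite linear0 addr0.
congr (_, _) => /=; last by rewrite linearN dyx addNr.
by apply: f_inj; rewrite !linearN opprK cmapP -dyx cdiffK linear0.
Qed.

Definition sub_to_cone_fun i (x : shift X i) : cone g i := (f (i + 1) x, 0).

Fact sub_to_cone_linear i : linear (@sub_to_cone_fun i).
Proof. by move=> a u v; congr (_, _); rewrite /= ?linearP // scaler0 addr0. Qed.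

Fact sub_to_cone_chain i (x : shift X i) :
  sub_to_cone_fun (cdiff (shift X) i x) = cdiff (cone g) i (sub_to_cone_fun x).
Proof. by congr (_, _); rewrite /= ?linearN ?cmapP // gf0 linear0 addr0. Qed.

Definition sub_to_cone : chmap (shift X) (cone g) :=
  @ChMap _ _ (shift X) (cone g) (fun i => mk_linear (@sub_to_cone_linear i))
    sub_to_cone_chain.

(** The dual chase: the cone of an epimorphism is the shift of its kernel, since surjectivity of [g]
    allows the [Z]-component of a cycle to be removed by a boundary. *)
Lemma qis_sub_to_cone : qis sub_to_cone.
Proof.
move=> i; split=> [x /= dx [[y z]] [fx gyz] | [y z] [/= dy gydz]].
  have [y' y'z] := g_surj z.
  have /fg_exact[x' yx'] : g (i + 1) (y + cdiff Y i y') = 0.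
    by rewrite linearD cmapP y'z -gyz.
  exists x'; apply: f_inj; rewrite linearN cmapP -yx' linearD cdiffK addr0.
  exact: fx.
have [y' y'z] := g_surj z.
have /fg_exact[x yx] : g (i + 1 + 1) (y + cdiff Y (i + 1) y') = 0.
  by rewrite linearD cmapP y'z.
exists x.
  apply/eqP; rewrite oppr_eq0; apply/eqP/f_inj.
  rewrite linear0 cmapP -yx linearD cdiffK addr0.
  by apply/eqP; rewrite -oppr_eq0 dy.
exists (- y', 0); congr (_, _) => /=.
  by rewrite -yx linearN opprK.
by rewrite linearN y'z linear0 addr0 subrr.
Qed.

End ShortExactSequences.

Section DirectSumSwap.
Variables (A : nzRingType) (e : A) (Y Z : cochain e).

Definition dsum_swap_fun i (v : dsum Y Z i) : dsum Z Y i := (v.2, v.1).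

Fact dsum_swap_linear i : linear (@dsum_swap_fun i).
Proof. by []. Qed.

Definition dsum_swap : chmap (dsum Y Z) (dsum Z Y) :=
  @ChMap _ _ (dsum Y Z) (dsum Z Y) (fun i => mk_linear (@dsum_swap_linear i))
    (fun _ _ => erefl).

(** Lets [thick_summand], which extracts the first summand, reach the second one too. *)
Lemma dsumC : disomorphic (dsum Y Z) (dsum Z Y).
Proof.
apply: (@qis_disomorphic _ _ _ _ dsum_swap); apply: qis_bij => i.
  by move=> [y z] [y' z'] [-> ->].
by move=> [z y]; exists (y, z).
Qed.

End DirectSumSwap.

(** * Closure of thick subcategories under extensions and direct sums *)

Section ThickSubcategories.
Variables (A : nzRingType) (e : A) (P : dbcat e -> Prop).
Hypothesis thickP : thick P.

(** The standard triangle of [f], with its cone replaced by [Z] along the inverse of [s], is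
    distinguished. *)
Lemma thick_qis_from_cone (X Y Z : dbcat e) (f : chmap X Y) (s : chmap (cone f) Z) :
  qis s -> P X -> P Y -> P Z.
Proof.
move=> qs; pose c := dinv qs.
apply: (thick_cone thickP (u := dmap f) (v := dcomp (dmap s) (dmap (cone_in f)))
  (w := dcomp (dmap (cone_out f)) c)).
exists X, Y, f, (dmap (chmap_id X)), (dmap (chmap_id Y)), c.
split; split; [exact: diso_id | exact: diso_id | exact: diso_inv | | | ].
- exact: deq_trans (deq_idl _) (deq_sym (deq_idr _)).
- apply: deq_trans (deq_sym (deq_idr _)).
  exact: deq_cancell (deq_invl _).
- apply: deq_trans (deq_idl _).
  by apply: deq_comp; [apply: deq_map | apply: deq_refl].
Qed.

(** The same replacement for a quasi-isomorphism in the other direction; the formal inverse now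
    occurs in the second map of the triangle. *)
Lemma thick_qis_to_cone (X Y Z : dbcat e) (f : chmap X Y) (s : chmap Z (cone f)) :
  qis s -> P X -> P Y -> P Z.
Proof.
move=> qs; pose c := dmap s.
apply: (thick_cone thickP (u := dmap f) (v := dcomp (dinv qs) (dmap (cone_in f)))
  (w := dcomp (dmap (cone_out f)) c)).
exists X, Y, f, (dmap (chmap_id X)), (dmap (chmap_id Y)), c.
split; split; [exact: diso_id | exact: diso_id | | | | ].
- by exists (dinv qs); split; [apply: deq_invl | apply: deq_invr].
- exact: deq_trans (deq_idl _) (deq_sym (deq_idr _)).
- apply: deq_trans (deq_sym (deq_idr _)).
  exact: deq_cancell (deq_invr _).
- apply: deq_trans (deq_idl _).
  by apply: deq_comp; [apply: deq_map | apply: deq_refl].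
Qed.

Lemma thick_dbshift (X : dbcat e) : P X <-> P (dbshift X).
Proof. by apply: (thick_shift thickP); apply: disomorphic_refl. Qed.

Section ShortExact.
Variables (X Y Z : dbcat e) (f : chmap X Y) (g : chmap Y Z).
Hypothesis f_inj : forall i, injective (f i).
Hypothesis g_surj : forall i z, exists y, g i y = z.
Hypothesis gf0 : forall i x, g i (f i x) = 0.
Hypothesis fg_exact : forall i y, g i y = 0 -> exists x, y = f i x.

Lemma thick_ses_quo : P X -> P Y -> P Z.
Proof.
by apply: thick_qis_from_cone; apply: (qis_cone_to_quo f_inj g_surj gf0 fg_exact).
Qed.

Lemma thick_ses_sub : P Y -> P Z -> P X.
Proof.
move=> PY PZ; apply/thick_dbshift; move: PY PZ.
apply: (@thick_qis_to_cone _ _ (dbshift X)).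
exact: (qis_sub_to_cone f_inj g_surj gf0 fg_exact).
Qed.

End ShortExact.

Section DirectSum.
Variables Y Z : dbcat e.

(** The cone of this zero map is the shift of [dsum Y Z]: the terms coincide, and the sign in the
    differential of [shift Z] makes the differentials agree. *)
Definition zero_to_shift : chmap Y (shift Z) :=
  @ChMap _ _ Y (shift Z) (fun=> \0) (fun i x => esym (linear0 (cdiff (shift Z) i))).

Definition dsum_to_cone_fun i (v : shift (dsum Y Z) i) : cone zero_to_shift i := v.

Fact dsum_to_cone_linear i : linear (@dsum_to_cone_fun i).
Proof. by []. Qed.

Fact dsum_to_cone_chain i (v : shift (dsum Y Z) i) :
  dsum_to_cone_fun (cdiff (shift (dsum Y Z)) i v) =
  cdiff (cone zero_to_shift) i (dsum_to_cone_fun v).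
Proof. by congr (_, _); rewrite /= add0r. Qed.

Definition dsum_to_cone : chmap (shift (dsum Y Z)) (cone zero_to_shift) :=
  @ChMap _ _ (shift (dsum Y Z)) (cone zero_to_shift)
    (fun i => mk_linear (@dsum_to_cone_linear i)) dsum_to_cone_chain.

Lemma qis_dsum_to_cone : qis dsum_to_cone.
Proof. by apply: qis_bij => [i x y xy | i y]; [exact: xy | exists y]. Qed.

End DirectSum.

(** Closure under cones puts the shifted sum in [P], and closure under the inverse shift brings back
    the sum itself. *)
Lemma thick_dsum (X Y Z : dbcat e) :
  disomorphic X (dsum Y Z) -> P Y -> P Z -> P X.
Proof.
move=> XYZ PY /thick_dbshift PZ; apply/thick_dbshift.
have dbS : Db_fg (shift (dsum Y Z)).
  apply: Db_fg_shift; have [X' X'fg XX'] := dbobP X.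
  by exists X' => //; apply: disomorphic_trans XX'; apply: disomorphic_sym.
have : P (DbCat dbS).
  by apply: (@thick_qis_to_cone Y (dbshift Z) (DbCat dbS) _ _ _ PY PZ);
     apply: qis_dsum_to_cone.
by apply: (thick_iso thickP); apply/disomorphic_shift/disomorphic_sym.
Qed.

End ThickSubcategories.

(** * Modules as complexes concentrated in degree zero *)

Section StalkMaps.
Variables (A : nzRingType) (e : A).
Implicit Types M N : blockmod e.

Definition stalk_lin M N (f : {linear M -> N}) i :
    {linear stalk_ob M i -> stalk_ob N i} :=
  match i with Posz 0 => f | _ => \0 end.

Fact stalk_map_chain M N (f : {linear M -> N}) i (x : stalk M i) :
  stalk_lin f (i + 1) (cdiff (stalk M) i x) = cdiff (stalk N) i (stalk_lin f i x).
Proof. by rewrite /= linear0. Qed.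

Definition stalk_map M N (f : {linear M -> N}) : chmap (stalk M) (stalk N) :=
  @ChMap _ _ (stalk M) (stalk N) (stalk_lin f) (stalk_map_chain f).

Lemma bzero_eq0 (x : bzero e) : x = 0.
Proof. by rewrite [LHS]thinmx0 [RHS]thinmx0. Qed.

(** A short exact sequence of modules gives one of stalk complexes, trivially exact in nonzero
    degrees; the quotient and the kernel are then handled by [thick_ses_quo] and [thick_ses_sub]. *)
Lemma thick_stalk_ses (P : dbcat e -> Prop) (M1 M2 M3 : blockmod e)
    (fg1 : fingen M1) (fg2 : fingen M2) (fg3 : fingen M3)
    (f : {linear M1 -> M2}) (g : {linear M2 -> M3}) :
    thick P -> injective f -> (forall z, exists y, g y = z) ->
    (forall x, g (f x) = 0) -> (forall y, g y = 0 -> exists x, y = f x) ->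
    P (db_stalk fg2) ->
  P (db_stalk fg1) <-> P (db_stalk fg3).
Proof.
move=> thickP f_inj g_surj gf0 fg_exact PM2.
have F_inj i : injective (stalk_map f i).
  by case: i => [[|n]|n] //= x y _; rewrite (bzero_eq0 x) (bzero_eq0 y).
have G_surj i z : exists y, stalk_map g i y = z.
  by case: i z => [[|n]|n] //= z; exists 0; rewrite (bzero_eq0 z).
have GF0 i x : stalk_map g i (stalk_map f i x) = 0.
  by case: i x => [[|n]|n] /=.
have FG i y : stalk_map g i y = 0 -> exists x, y = stalk_map f i x.
  by case: i y => [[|n]|n] //= y _; exists 0; rewrite (bzero_eq0 y).
split=> PM.
  exact: (@thick_ses_quo _ _ _ thickP (db_stalk fg1) (db_stalk fg2) (db_stalk fg3)
            _ _ F_inj G_surj GF0 FG).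
exact: (@thick_ses_sub _ _ _ thickP (db_stalk fg1) (db_stalk fg2) (db_stalk fg3)
          _ _ F_inj G_surj GF0 FG).
Qed.

Section StalkSum.
Variables (M M1 M2 : blockmod e) (f : {linear M -> (M1 * M2)%type}).

Definition stalk_sum_fun i : stalk M i -> dsum (stalk M1) (stalk M2) i :=
  match i with Posz 0 => f | _ => \0 end.

Fact stalk_sum_linear i : linear (@stalk_sum_fun i).
Proof.
by case: i => [[|n]|n] a u v /=; [apply: linearP | rewrite scaler0 addr0 ..].
Qed.

Fact stalk_sum_chain i (x : stalk M i) :
  stalk_sum_fun (cdiff (stalk M) i x) =
  cdiff (dsum (stalk M1) (stalk M2)) i (stalk_sum_fun x).
Proof.
(* All differentials are zero, so the claim is that zero is sent to zero. *)
exact: (raddf0 (mk_linear (@stalk_sum_linear (i + 1)))).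
Qed.

Definition stalk_sum : chmap (stalk M) (dsum (stalk M1) (stalk M2)) :=
  @ChMap _ _ (stalk M) (dsum (stalk M1) (stalk M2))
    (fun i => mk_linear (@stalk_sum_linear i)) stalk_sum_chain.

Lemma disomorphic_stalk_sum : injective f -> (forall y, exists x, f x = y) ->
  disomorphic (stalk M) (dsum (stalk M1) (stalk M2)).
Proof.
move=> f_inj f_surj; apply: (@qis_disomorphic _ _ _ _ stalk_sum).
apply: qis_bij => [] [[|n]|n] //=.
- by move=> x y _; rewrite (bzero_eq0 x) (bzero_eq0 y).
- by move=> x y _; rewrite (bzero_eq0 x) (bzero_eq0 y).
- by move=> [y z]; exists 0; rewrite (bzero_eq0 y) (bzero_eq0 z).
- by move=> [y z]; exists 0; rewrite (bzero_eq0 y) (bzero_eq0 z).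
Qed.

End StalkSum.
End StalkMaps.

(** * Quotients by annihilators and Frobenius reciprocity *)

Section QuotientLift.
Variables (A : nzRingType) (M N : lmodType A) (S : submodule M).
Variable f : {linear M -> N}.
Hypothesis fS : forall x, x \in smem S -> f x = 0.

Definition quot_lift_fun (x : quot_mod S) : N := f (quot_repr x).

Lemma quot_lift_proj x : quot_lift_fun (quot_proj S x) = f x.
Proof.
apply/eqP; rewrite -subr_eq0 -linearB; apply/eqP/fS.
by rewrite -quot_proj_eq quot_reprK.
Qed.

Fact quot_lift_linear : linear quot_lift_fun.
Proof.
move=> a x y; rewrite -[x]quot_reprK -[y]quot_reprK -linearP.
by rewrite !quot_lift_proj linearP.
Qed.

Definition quot_lift : {linear quot_mod S -> N} := mk_linear quot_lift_linear.

Lemma quot_lift_inj :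
  (forall x, f x = 0 -> x \in smem S) -> injective quot_lift.
Proof.
move=> kerf x y; rewrite -[x]quot_reprK -[y]quot_reprK /= !quot_lift_proj => fxy.
by apply/eqP; rewrite quot_proj_eq kerf // linearB fxy subrr.
Qed.

End QuotientLift.

Section AnnihilatorFacts.
Variables (A : nzRingType) (M : lmodType A).

Lemma ann_smul_gen (N : lmodType A) (a : A) (x : N) :
  annihilator M a -> a *: x \in smem (ann_submodule M N).
Proof.
move=> aM; apply/asboolP; exists [:: (a, x)].
by split=> [p|]; rewrite ?big_seq1 // inE => /eqP->.
Qed.

Lemma ann_smul_map (N N' : lmodType A) (f : {linear N -> N'}) x :
  x \in smem (ann_submodule M N) -> f x \in smem (ann_submodule M N').
Proof.
move=> /asboolP[s [sI ->]]; apply/asboolP; exists [seq (p.1, f p.2) | p <- s].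
split=> [_ /mapP[p /sI pI ->] //|].
by rewrite big_map linear_sum; apply: eq_bigr => p _; rewrite linearZ.
Qed.

Lemma ann_smul_self (x : M) : x \in smem (ann_submodule M M) -> x = 0.
Proof.
move=> /asboolP[s [sI ->]]; rewrite big_seq big1 // => p /sI; exact.
Qed.

End AnnihilatorFacts.

(** * Induced modules as left ideals, and maps out of them *)

Section InductionIdeal.
Variables (gT : finGroupType) (R : fieldType).
Local Notation A := (galg gT R).

(** The scalar [r] inside the group algebra: modules carry only an action of [A], so division by an
    invertible integer is the action of such an element. *)
Definition gscal (r : R) : A := [ffun g => if g == 1%g then r else 0].
Definition gdelta (x : gT) : A := [ffun g => (g == x)%:R].

Lemma gscal_natV n (M : lmodType A) (v : M) :
  n%:R != 0 :> R -> gscal n%:R^-1 *: (v *+ n) = v.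
Proof.
move=> n0; rewrite -scaler_nat scalerA (_ : _ * _ = 1) ?scale1r //.
rewrite mulr_natr; apply/ffunP=> g; rewrite !ffunMnE !ffunE.
by case: ifP => _; rewrite ?mul0rn // -[_ *+ _]mulr_natr mulVf.
Qed.

Lemma natmul_eq0 n (M : lmodType A) (v : M) :
  n%:R != 0 :> R -> v *+ n = 0 -> v = 0.
Proof. by move=> n0 vn; rewrite -(gscal_natV v n0) vn scaler0. Qed.

Section Ideal.
Variables (H : {group gT}) (chi : linchar R H).
Local Notation Ind := (ind_mod chi).

Lemma gscal_indE r (f : Ind) g :
  (gscal r *: f : indfun chi) g = r * (f : indfun chi) g.
Proof.
rewrite ind_scaleE (bigD1 1%g) //= big1 => [|x /negPf x1].
  by rewrite ffunE eqxx mulg1 addr0.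
by rewrite ffunE x1 mul0r.
Qed.

Lemma gdelta_indE x (f : Ind) g :
  (gdelta x *: f : indfun chi) g = (f : indfun chi) (g * x)%g.
Proof.
rewrite ind_scaleE (bigD1 x) //= big1 => [|y /negPf yx].
  by rewrite ffunE eqxx mul1r addr0.
by rewrite ffunE yx mul0r.
Qed.

Lemma ind_mulrnE (f : Ind) n g :
  (f *+ n : indfun chi) g = (f : indfun chi) g *+ n.
Proof. by elim: n => [|n IHn]; rewrite ?mulrS -?IHn /= ffunE. Qed.

(** Inversion realizes the induced module as a left ideal of the group algebra. *)
Definition ind_ideal (f : Ind) : A := [ffun g => (f : indfun chi) g^-1%g].

Lemma ind_idealP a (f f' : Ind) :
  ind_ideal (a *: f + f') = a * ind_ideal f + ind_ideal f'.
Proof.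
apply/ffunP=> g; rewrite !ffunE ind_scaleE; congr (_ + _).
by apply: eq_bigr => x _; rewrite ffunE invMg invgK.
Qed.

(** After the substitution only the terms indexed by [H] survive, and each equals [f g] because the
    values of [chi] at [x] and at its inverse cancel. *)
Lemma ind_ideal_scale (f : Ind) : ind_ideal f *: ind_gen chi = f *+ #|H|.
Proof.
apply/val_inj/ffunP=> g; rewrite [LHS]ind_scaleE.
rewrite ind_mulrnE -sumr_const.
rewrite (reindex_inj (mulgI g^-1%g)) /= [RHS]big_mkcond /=.
apply: eq_bigr => x _; rewrite !ffunE mulKVg invMg invgK.
case: ifP => xH; last by rewrite mulr0.
have /ind_predP-> := valP (f : indfun chi); last by rewrite groupV.
rewrite mulrC -[_ *: _]/(_ * _) mulrA -lcharM ?groupV // mulgV lchar1.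
by rewrite mul1r.
Qed.

Lemma ind_idealM (f : Ind) : ind_ideal f * ind_ideal (ind_gen chi) = ind_ideal f *+ #|H|.
Proof.
have := ind_idealP (ind_ideal f) (ind_gen chi) 0.
have -> : ind_ideal 0 = 0 by apply/ffunP=> g; rewrite !ffunE.
rewrite !addr0 ind_ideal_scale => <-.
by apply/ffunP=> g; rewrite ffunMnE !ffunE ind_mulrnE.
Qed.

(** [ind_ideal (ind_gen chi)] is thus the projector onto the [chi]-isotypic vectors of [H],
    multiplied by the order of [H]. *)
Lemma ind_ideal_genE (K : {group gT}) (psi : linchar R K) (v : ind_mod psi) g :
  (ind_ideal (ind_gen chi) *: v : indfun psi) g =
  \sum_(h in H) chi h^-1%g * (v : indfun psi) (g * h)%g.
Proof.
rewrite ind_scaleE [RHS]big_mkcond; apply: eq_bigr => h _.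
by rewrite !ffunE groupV; case: ifP => // _; rewrite mul0r.
Qed.

Section Frobenius.
Variables (M : lmodType A) (m : M).

(** For a [chi]-equivariant [m] this is the map given by Frobenius reciprocity, multiplied by the
    order of [H]: the generator goes to [m *+ #|H|]. *)
Definition frob_fun (f : Ind) : M := ind_ideal f *: m.

Fact frob_linear : linear frob_fun.
Proof. by move=> a f f'; rewrite /frob_fun ind_idealP scalerDl scalerA. Qed.

Definition frob : {linear Ind -> M} := mk_linear frob_linear.

Lemma frob_ann f : f \in smem (ann_submodule M Ind) -> frob f = 0.
Proof. by move/(ann_smul_map frob)/ann_smul_self. Qed.

Hypothesis H0 : #|H|%:R != 0 :> R.

(** Up to the invertible factor [#|H|], [f] is [ind_ideal f] applied to the generator, so it
    suffices that [ind_ideal f] annihilates [M]. By [ind_idealM] it may be tested on the image of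
    the projector, where the hypothesis reduces it to [m]. *)
Lemma frob_ker f :
  (forall (v : M) (a : A), a *: m = 0 -> a *: (ind_ideal (ind_gen chi) *: v) = 0) ->
  frob f = 0 -> f \in smem (ann_submodule M Ind).
Proof.
move=> em fm; rewrite -(gscal_natV f H0) -ind_ideal_scale scalerA.
apply: ann_smul_gen => v.
have fv0 : ind_ideal f *: v = 0; last by rewrite -scalerA fv0 scaler0.
apply: (natmul_eq0 H0); rewrite scalerMnl -ind_idealM -scalerA; exact: em.
Qed.

Lemma frob_onto v : frob (ind_gen chi) = m *+ #|H| ->
  (exists a, v = a *: m) -> exists f, frob f = v.
Proof.
move=> fgen [a ->]; exists (a *: (gscal #|H|%:R^-1 *: ind_gen chi)).
by rewrite !linearZ fgen /= gscal_natV.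
Qed.

End Frobenius.
End Ideal.
End InductionIdeal.

(** * Functions on the projective line *)

Section GL2Facts.
Variable k : finFieldType.
Local Notation G := {'GL_2[k]}.
Local Notation mx u := (GLval u : 'M[k]_2).

Lemma GL2_row1 (g : G) : mx g 1 0 = 0 -> mx g 1 1 != 0.
Proof.
by move=> g0; apply: contraTneq (GL2_det g) => g1; rewrite g0 g1 !mulr0 subrr eqxx.
Qed.

Lemma uni_nz (x : k) : 1 * 1 - x * 0 != 0.
Proof. by rewrite mulr0 subr0 mulr1 oner_eq0. Qed.

Definition uni (x : k) : G := GL2 (uni_nz x).
Definition weyl : G := GL2 (bruhat_nz_w k).

Lemma uni_unip x : uni x \in unip k.
Proof. by rewrite inE !mxE !eqxx. Qed.

Lemma uniD x y : uni (x + y) = (uni x * uni y)%g.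
Proof. by apply: GL2_eqP; rewrite !GL2_ME !mxE /=; split; ring. Qed.

Lemma uni0 : uni 0 = 1%g.
Proof. by apply: GL2_eqP; rewrite !GL2_1E !mxE. Qed.

Lemma uniV x : (uni x)^-1%g = uni (- x).
Proof. by apply: (mulgI (uni x)); rewrite mulgV -uniD subrr uni0. Qed.

Lemma unipP u : reflect (exists x, u = uni x) (u \in unip k).
Proof.
apply: (iffP idP) => [|[x ->]]; last exact: uni_unip.
rewrite inE => /and3P[/eqP u10 /eqP u00 /eqP u11]; exists (mx u 0 1).
by apply: GL2_eqP; rewrite !mxE.
Qed.

Lemma unip_sub_borel : unip k \subset borel k.
Proof. by apply/subsetP => u; rewrite !inE => /and3P[]. Qed.

Lemma big_unip (R : nmodType) (F : G -> R) :
  \sum_(u in unip k) F u = \sum_x F (uni x).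
Proof.
rewrite (reindex_onto uni (fun u => mx u 0 1)) /=; last first.
  by move=> u /unipP[x ->]; rewrite mxE.
by apply: eq_bigl => x; rewrite [_ \in _]uni_unip mxE /= eqxx.
Qed.

(** The coset of [g] modulo [borel] is the point of the projective line given by its bottom row; the
    open cell has the ratio of the two entries as coordinate. *)
Lemma bruhat_uni (g : G) : mx g 1 0 != 0 ->
  exists2 b, b \in borel k & g = (b * (weyl * uni (mx g 1 1 / mx g 1 0)%R))%g.
Proof.
set c := mx g 1 0 => c0; have D0 := GL2_det g; set D := _ - _ in D0.
have nz : (- D / c) * c - mx g 0 0 * 0 != 0.
  by rewrite mulr0 subr0 mulfVK // oppr_eq0.
exists (GL2 nz); rewrite ?inE ?mxE //.
apply: GL2_eqP; rewrite !GL2_ME !mxE /= /D -/c; split; by field.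
Qed.

Lemma row1_uni (g : G) x : mx (g * uni x)%g 1 0 = mx g 1 0 /\
  mx (g * uni x)%g 1 1 = mx g 1 0 * x + mx g 1 1.
Proof. by rewrite !GL2_ME !mxE /= mulr0 addr0 !mulr1. Qed.

Lemma row1_weyl (g : G) : mx (g * weyl)%g 1 0 = mx g 1 1 /\
  mx (g * weyl)%g 1 1 = mx g 1 0.
Proof. by rewrite !GL2_ME !mxE /= !mulr0 !mulr1 addr0 add0r. Qed.

End GL2Facts.

(** * The augmentation of [ind_borel] and generators of its kernel *)

Section BorelModule.
Variables (k : finFieldType) (R : fieldType).
Local Notation G := {'GL_2[k]}.
Local Notation mx u := (GLval u : 'M[k]_2).
Local Notation A := (galg G R).
Local Notation P := (ind_borel k R).
Local Notation fn f := (f : indfun (linchar_one R (borel k))).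
Local Notation delta := (ind_gen (linchar_one R (borel k))).

Lemma borel_fun_inv (f : P) b g : b \in borel k -> fn f (b * g)%g = fn f g.
Proof. by move=> bB; have /ind_predP-> := valP (fn f); rewrite ?scale1r. Qed.

Lemma borel_funE (f : P) (g : G) : fn f g =
  if mx g 1 0 == 0 then fn f 1%g else fn f (weyl k * uni (mx g 1 1 / mx g 1 0)%R)%g.
Proof.
case: ifP => [g0|/negbT/bruhat_uni[b bB {1}->]]; last exact: borel_fun_inv.
by rewrite -[g]mulg1 borel_fun_inv // inE.
Qed.

Lemma deltaE (g : G) : fn delta g = (mx g 1 0 == 0)%:R.
Proof. by rewrite /= !ffunE inE; case: ifP. Qed.

Lemma borel_funB (u v : P) g : fn (u - v) g = fn u g - fn v g.
Proof. by rewrite /= !ffunE. Qed.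

(** Summing over the group rather than over the projective line multiplies the usual augmentation by
    the order of [borel]. *)
Definition aug_fun (f : P) : triv_mod G R := \sum_g fn f g.

Fact aug_linear : linear aug_fun.
Proof.
move=> a f f'; rewrite /aug_fun triv_scaleE.
under eq_bigr => g _ do rewrite /= ffunE ind_scaleE.
rewrite big_split /=; congr (_ + _); rewrite exchange_big mulr_suml /=.
apply: eq_bigr => x _; rewrite -mulr_sumr; congr (_ * _).
by rewrite [RHS](reindex_inj (mulIg x)).
Qed.

Definition aug : {linear P -> triv_mod G R} := mk_linear aug_linear.

Lemma aug_delta : aug delta = #|borel k|%:R.
Proof.
rewrite -sum1_card natr_sum [RHS]big_mkcond; apply: eq_bigr => g _.
by rewrite deltaE inE; case: ifP.
Qed.

Definition cyc (m v : P) : Prop := exists a : A, v = a *: m.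

Lemma cycZ m a v : cyc m v -> cyc m (a *: v).
Proof. by move=> [b ->]; exists (a * b); rewrite scalerA. Qed.

Lemma cycD m u v : cyc m u -> cyc m v -> cyc m (u + v).
Proof. by move=> [a ->] [b ->]; exists (a + b); rewrite scalerDl. Qed.

Lemma cycB m u v : cyc m u -> cyc m v -> cyc m (u - v).
Proof. by move=> [a ->] [b ->]; exists (a - b); rewrite scalerBl. Qed.

Lemma cyc_sum m (I : finType) (Q : pred I) (F : I -> P) :
  (forall i, Q i -> cyc m (F i)) -> cyc m (\sum_(i | Q i) F i).
Proof.
move=> mF; elim/big_rec: _ => [|i v Qi]; first by exists 0; rewrite scale0r.
by apply: cycD; apply: mF.
Qed.

Lemma gdeltaM (g h : G) (v : P) :
  gdelta R (g * h)%g *: v = gdelta R g *: (gdelta R h *: v).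
Proof.
by apply/val_inj/ffunP => x; rewrite [LHS]gdelta_indE [RHS]gdelta_indE gdelta_indE mulgA.
Qed.

Lemma gdelta_delta b : b \in borel k -> gdelta R b *: delta = delta.
Proof.
by move=> bB; apply/val_inj/ffunP => x; rewrite [LHS]gdelta_indE !ffunE groupMr.
Qed.

Hypothesis B0 : #|borel k|%:R != 0 :> R.

(** An element [a *: delta] of the kernel has coefficient sum zero, hence is a combination of
    differences [g delta - delta]; by the Bruhat decomposition each is zero or a [borel]-translate
    of the one for [weyl]. *)
Lemma ker_aug_cyc m : cyc m (gdelta R (weyl k) *: delta - delta) ->
  forall v, aug v = 0 -> cyc m v.
Proof.
move=> mw v; have [a ->] := ind_genP v.
move=> av0; have /eqP : (\sum_g a g) * #|borel k|%:R = 0 :> R.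
  by rewrite -aug_delta -triv_scaleE -[RHS]av0 linearZ.
rewrite mulf_eq0 (negPf B0) orbF => /eqP a0.
have mg g : cyc m (gdelta R g *: delta - delta).
  have [gB|/bruhat[b [b' [bB b'B ->]]]] := boolP (g \in borel k).
    by rewrite gdelta_delta // subrr; exists 0; rewrite scale0r.
  rewrite !gdeltaM (gdelta_delta b'B) -{2}(gdelta_delta bB) -scalerBr.
  exact: cycZ.
have -> : a *: delta = \sum_g gscal G (a g) *: (gdelta R g *: delta - delta).
  have sum_fn (F : G -> P) x : fn (\sum_g F g) x = \sum_g fn (F g) x.
    by apply: (big_morph (fun f => fn f x)) => [u w|] /=; rewrite ffunE.
  apply/val_inj/ffunP => x; rewrite [LHS]ind_scaleE [RHS]sum_fn.
  (* This zero sum is subtracted to turn the translates of [delta] into differences. *)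
  have ax0 : \sum_g a g * fn delta x = 0 by rewrite -mulr_suml a0 mul0r.
  rewrite -[LHS]subr0 -[X in _ - X]ax0 -sumrB.
  apply: eq_bigr => g _.
  by rewrite gscal_indE borel_funB gdelta_indE mulrBr.
by apply: cyc_sum => g _; apply: cycZ.
Qed.

End BorelModule.
Arguments aug {k R}.

(** * Vectors of [ind_borel] equivariant for a character of the unipotent group *)

Section UnipotentCharacter.
Variables (k : finFieldType) (R : fieldType) (chi : linchar R (unip k)).
Local Notation G := {'GL_2[k]}.
Local Notation mx u := (GLval u : 'M[k]_2).
Local Notation A := (galg G R).
Local Notation P := (ind_borel k R).
Local Notation fn f := (f : indfun (linchar_one R (borel k))).
Local Notation delta := (ind_gen (linchar_one R (borel k))).
Local Notation eps := (ind_ideal (ind_gen chi)).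

Definition uchar (x : k) : R := chi (uni x).

Lemma uchar0 : uchar 0 = 1.
Proof. by rewrite /uchar uni0 lchar1. Qed.

Lemma ucharD x y : uchar (x + y) = uchar x * uchar y.
Proof. by rewrite /uchar uniD lcharM ?uni_unip. Qed.

Lemma epsE (v : P) g : fn (eps *: v) g = \sum_x uchar (- x) * fn v (g * uni x)%g.
Proof.
by rewrite ind_ideal_genE big_unip; apply: eq_bigr => x _; rewrite uniV.
Qed.

Definition equivariant (v : P) :=
  forall g x, fn v (g * uni x)%g = uchar x * fn v g.

Lemma eps_equivariant v : equivariant (eps *: v).
Proof.
move=> g y; rewrite !epsE (reindex_inj (addrI (- y))) mulr_sumr /=.
apply: eq_bigr => x _; rewrite -mulgA -uniD addNKr opprD opprK ucharD.
by rewrite mulrA.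
Qed.

Lemma equivariant_eps v : equivariant v -> eps *: v = v *+ #|unip k|.
Proof.
move=> v_eqv; apply/val_inj/ffunP=> g; rewrite [LHS]epsE ind_mulrnE.
rewrite -sumr_const big_unip; apply: eq_bigr => x _.
by rewrite v_eqv mulrA -ucharD addNr uchar0 mul1r.
Qed.

Hypothesis chi_nontriv : exists2 u, u \in unip k & chi u != 1.

Lemma uchar_nontriv : exists x, uchar x != 1.
Proof. by have [_ /unipP[x ->] x1] := chi_nontriv; exists x. Qed.

(** The form in which nontriviality of [chi] enters: it kills the character sum, the value of an
    equivariant function on the closed cell, and the augmentation of [whit]. *)
Lemma eigen_eq0 r : (forall x, uchar x * r = r) -> r = 0.
Proof.
have [x x1] := uchar_nontriv => /(_ x)/eqP.
rewrite -subr_eq0 -{2}[r]mul1r -mulrBl mulf_eq0 subr_eq0 (negPf x1) /=.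
by move/eqP.
Qed.

Lemma sum_uchar : \sum_x uchar x = 0.
Proof.
apply: eigen_eq0 => y; rewrite mulr_sumr [RHS](reindex_inj (addrI y)) /=.
by apply: eq_bigr => x _; rewrite ucharD.
Qed.

Fact whit_subproof :
  [ffun g : G => (if mx g 1 0 == 0 then 0 else uchar (mx g 1 1 / mx g 1 0)) : R^o]
    \in ind_pred (linchar_one R (borel k)).
Proof.
apply/ind_predP => b g; rewrite inE => /eqP b0; rewrite !ffunE !GL2_ME b0.
have b1 := GL2_row1 b0; rewrite !mul0r !add0r mulf_eq0 (negPf b1) /= scale1r.
by case: eqP => // _; rewrite -mulf_div divff ?mul1r.
Qed.

(** The line of equivariant vectors in [ind_borel] is spanned by [whit], which
    is supported on the open cell. *)
Definition whit : P := IndFun whit_subproof.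

Lemma whitE g : fn whit g =
  if mx g 1 0 == 0 then 0 else uchar (mx g 1 1 / mx g 1 0).
Proof. by rewrite ffunE. Qed.

Lemma whit_equivariant : equivariant whit.
Proof.
move=> g x; have [g10 g11] := row1_uni g x; rewrite !whitE g10 g11.
case: eqP => [_|/eqP g0]; first by rewrite mulr0.
by rewrite -ucharD; congr uchar; field.
Qed.

(** On the open cell equivariance fixes everything from the value at [weyl]; on the closed cell
    [uni x] lies in [borel], so the value is at once invariant and multiplied by [uchar x]. *)
Lemma equivariant_whit v : equivariant v ->
  forall g, fn v g = fn v (weyl k) * fn whit g.
Proof.
move=> v_eqv g; rewrite borel_funE whitE; case: eqP => _; last first.
  by rewrite v_eqv mulrC.
rewrite mulr0; apply: eigen_eq0 => x; rewrite -v_eqv mul1g.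
by rewrite -[uni x]mulg1 borel_fun_inv // (subsetP (unip_sub_borel k)) ?uni_unip.
Qed.

(** The image of the projector lies in the line of [whit]; this is the hypothesis of [frob_ker]. *)
Lemma whit_eps (v : P) (a : A) : a *: whit = 0 -> a *: (eps *: v) = 0.
Proof.
move=> aw; apply/val_inj/ffunP=> g; rewrite [LHS]ind_scaleE.
under eq_bigr => x _ do
  rewrite (equivariant_whit (eps_equivariant v)) mulrCA.
by rewrite -mulr_sumr -ind_scaleE aw /= !ffunE mulr0.
Qed.

Lemma aug_whit : aug whit = 0.
Proof.
apply: eigen_eq0 => x; rewrite /= /aug_fun [RHS](reindex_inj (mulIg (uni x))) /=.
rewrite mulr_sumr.
by apply: eq_bigr => g _; rewrite -whit_equivariant.
Qed.

Hypothesis q1 : #|k|%:R = -1 :> R.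

Let sum_uchar_nz (y : k) : \sum_(t | t != 0) uchar (y / t) = - (1 + (y == 0)%:R).
Proof.
have [->|y0] := eqVneq y 0.
  under eq_bigr => t _ do rewrite mul0r uchar0.
  rewrite sumr_const cardC1 -subn1 natrB; last by apply/card_gt0P; exists 0.
  by rewrite q1 opprD.
(* With the convention that the inverse of zero is zero, this map permutes [k] and fixes zero, so
   the sum becomes the full character sum without its term 1. *)
have yI : injective (fun t => y / t).
  by move=> t u /(mulfI y0)/invr_inj.
have := sum_uchar; rewrite (bigD1 0) //= uchar0 (reindex_inj yI) /= addr0.
move/eqP; rewrite addrC addr_eq0 => /eqP <-.
by apply: eq_bigl => t; rewrite mulf_eq0 invr_eq0 negb_or y0.
Qed.

(** [insubd] makes the torus element total in [t], with the identity as value at zero. *)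
Let diag1 (t : k) : G := insubd (1%g : G) (mx2 t 0 0 1).

Let row1_diag1 (g : G) t : t != 0 ->
  mx (g * diag1 t)%g 1 0 = mx g 1 0 * t /\ mx (g * diag1 t)%g 1 1 = mx g 1 1.
Proof.
move=> t0; have nz : t * 1 - 0 * 0 != 0 by rewrite mulr1 mulr0 subr0.
have E : GLval (diag1 t) = mx2 t 0 0 1 by apply: insubdK; apply: mx2_unit nz.
by rewrite !GL2_ME E !mxE /= !mulr0 mulr1 addr0 add0r.
Qed.

Let lower_nz : 1 * 1 - 0 * (-1) != 0 :> k.
Proof. by rewrite mul0r subr0 mulr1 oner_eq0. Qed.

(** Averaging [whit] over the torus gives, up to sign, the sum of the indicators
    of the open cell and of [borel * weyl]; subtracting a translate leaves the
    difference of two points of the projective line. *)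
Lemma whit_cyc : cyc whit (gdelta R (weyl k) *: delta - delta).
Proof.
pose w1 : P := \sum_(t | t != 0) gdelta R (diag1 t) *: whit.
have w1E g : fn w1 g =
    if mx g 1 0 == 0 then 0 else - (1 + (mx g 1 1 == 0)%:R).
  rewrite /w1 (big_morph (fun f => fn f g) (id1 := 0) (op1 := +%R)); first last.
  - by rewrite /= ffunE.
  - by move=> u v; rewrite /= ffunE.
  case: ifP => [g0|/negbT g0].
    rewrite big1 // => t t0; rewrite gdelta_indE whitE.
    by have [-> _] := row1_diag1 g t0; rewrite (eqP g0) mul0r eqxx.
  transitivity (\sum_(t | t != 0) uchar (mx g 1 1 / mx g 1 0 / t)).
    apply: eq_bigr => t t0; rewrite gdelta_indE whitE.
    have [-> ->] := row1_diag1 g t0; rewrite mulf_eq0 (negPf g0) (negPf t0) /=.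
    by rewrite invfM mulrA.
  by rewrite sum_uchar_nz mulf_eq0 invr_eq0 (negPf g0) orbF.
have w1_cyc : cyc whit w1.
  by apply: cyc_sum => t _; apply: cycZ; exists 1; rewrite scale1r.
pose h := GL2 lower_nz.
(* For a bottom row [(c, d)] with [c] nonzero, translating [w1] by [uni 1] and subtracting leaves
   the indicator of [d = 0] minus that of [c + d = 0]. The element [h] turns the row into
   [(c - d, d)], which moves the second point to [c = 0]. *)
suff -> : gdelta R (weyl k) *: delta - delta =
    gdelta R h *: (gdelta R (uni 1) *: w1 - w1).
  by apply/cycZ/cycB => //; apply: cycZ.
apply/val_inj/ffunP=> g.
rewrite [LHS]borel_funB [RHS]gdelta_indE borel_funB !gdelta_indE !deltaE !w1E.
have [-> _] := row1_weyl g.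
have [-> ->] := row1_uni (g * h)%g 1.
have [-> ->] : mx (g * h)%g 1 0 = mx g 1 0 - mx g 1 1 /\ mx (g * h)%g 1 1 = mx g 1 1.
  by rewrite !GL2_ME !mxE /=; split; ring.
rewrite mulr1 subrK.
(* If [c = d], the moved row is in the closed cell, where [w1] vanishes, and the two indicators on
   the left coincide. *)
case: (eqVneq (mx g 1 0 - mx g 1 1) 0) => [/eqP|_]; last by ring.
rewrite subr_eq0 => /eqP->; by rewrite !subrr.
Qed.

End UnipotentCharacter.

(** * The trivial character of the unipotent group *)

Section TrivialCharacter.
Variables (k : finFieldType) (R : fieldType).
Local Notation G := {'GL_2[k]}.
Local Notation mx u := (GLval u : 'M[k]_2).
Local Notation A := (galg G R).
Local Notation P := (ind_borel k R).
Local Notation fn f := (f : indfun (linchar_one R (borel k))).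
Local Notation delta := (ind_gen (linchar_one R (borel k))).
Local Notation chi1 := (linchar_one R (unip k)).
Local Notation eps := (ind_ideal (ind_gen chi1)).

Lemma delta_equivariant : equivariant chi1 delta.
Proof.
move=> g x; rewrite /uchar mul1r !ffunE groupMr //.
by rewrite (subsetP (unip_sub_borel k)) ?uni_unip.
Qed.

(** A function invariant under the unipotent group is a combination of [delta] and a constant. An
    [a] killing [delta] has coefficient sum zero, by the augmentation, and so kills constants as
    well. *)
Lemma delta_eps (v : P) (a : A) : #|borel k|%:R != 0 :> R ->
  a *: delta = 0 -> a *: (eps *: v) = 0.
Proof.
move=> B0 ad.
have a0 : \sum_g a g = 0.
  have : (\sum_g a g) * #|borel k|%:R = 0 :> R.
    by rewrite -aug_delta -triv_scaleE -linearZ ad linear0.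
  by move/eqP; rewrite mulf_eq0 (negPf B0) orbF => /eqP.
pose w := fn (eps *: v) (weyl k).
have vE g : fn (eps *: v) g = (fn (eps *: v) 1%g - w) * fn delta g + w.
  rewrite borel_funE deltaE; case: eqP => _; first by rewrite mulr1 subrK.
  by rewrite mulr0 add0r eps_equivariant /uchar mul1r.
apply/val_inj/ffunP=> g; rewrite [LHS]ind_scaleE.
under eq_bigr => x _ do rewrite vE mulrDr mulrCA.
rewrite big_split -mulr_sumr -mulr_suml -ind_scaleE ad a0.
by rewrite /= !ffunE mulr0 mul0r addr0.
Qed.

End TrivialCharacter.

(** * The modules Q and V *)

Section QAndV.
Variables (k : finFieldType) (R : fieldType) (l : nat).
Hypotheses (charRl : l \in [pchar R]) (odd_l : odd l) (l_dvd : (l %| #|k|.+1)%N).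
Variable chi : linchar R (unip k).
Hypothesis chi_nontriv : exists2 u, u \in unip k & chi u != 1.
Local Notation G := {'GL_2[k]}.
Local Notation A := (galg G R).
Local Notation P := (ind_borel k R).
Local Notation e := (block1_idem G R).
Local Notation delta := (ind_gen (linchar_one R (borel k))).
Local Notation chi1 := (linchar_one R (unip k)).

Lemma card_field_char : #|k|%:R = -1 :> R.
Proof.
by apply/eqP; rewrite -addr_eq0 natr1 -(dvdn_pcharf charRl).
Qed.

(** As [q = -1] in [R], the order [q (q - 1)^2] becomes [-4], and [l] is odd. *)
Lemma card_borel_neq0 : #|borel k|%:R != 0 :> R.
Proof.
have two0 : 2%:R != 0 :> R.
  rewrite -(dvdn_pcharf charRl) gtnNdvd // ltn_neqAle.
  rewrite prime_gt1 ?(pcharf_prime charRl) // andbT.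
  by apply: contraTneq odd_l => <-.
rewrite card_borel -subn1 natrM natrX natrB; last by apply/card_gt0P; exists 0.
rewrite card_field_char mulf_neq0 ?oppr_eq0 ?oner_eq0 // expf_neq0 //.
by rewrite -opprD oppr_eq0.
Qed.

Lemma card_unip_neq0 : #|unip k|%:R != 0 :> R.
Proof.
have /dvdnP[n nE] := cardSg (unip_sub_borel k).
by have := card_borel_neq0; rewrite nE natrM mulf_eq0 negb_or => /andP[].
Qed.

Definition W_mod : lmodType A := quot_mod (ann_submodule P (ind_mod chi)).

Definition W_incl : {linear W_mod -> P} :=
  quot_lift (@frob_ann _ _ _ chi P (whit chi)).

Lemma W_incl_proj x : W_incl (quot_proj _ x) = frob chi (whit chi) x.
Proof. exact: (quot_lift_proj (@frob_ann _ _ _ chi P (whit chi))). Qed.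

Lemma W_incl_inj : injective W_incl.
Proof.
apply: quot_lift_inj => x x0; apply: (frob_ker card_unip_neq0 _ x0).
by move=> v a; apply: whit_eps.
Qed.

(** The image is the submodule generated by [whit], which has augmentation zero and generates the
    kernel by [whit_cyc] and [ker_aug_cyc]. *)
Lemma W_incl_image v : aug v = 0 <-> exists x, v = W_incl x.
Proof.
split=> [av0|[x ->]].
  have [||x <-] := @frob_onto _ _ _ chi P (whit chi) card_unip_neq0 v.
  - exact/equivariant_eps/whit_equivariant.
  - apply: ker_aug_cyc av0; first exact: card_borel_neq0.
    exact: whit_cyc card_field_char.
  by exists (quot_proj _ x); rewrite W_incl_proj.
rewrite -[x]quot_reprK W_incl_proj.
rewrite -[frob _ _ _]/(ind_ideal _ *: whit chi) linearZ aug_whit //.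
exact: scaler0.
Qed.

Lemma aug_onto z : exists v : P, aug v = z.
Proof.
exists (gscal G (z / #|borel k|%:R) *: delta).
rewrite linearZ [LHS]triv_scaleE aug_delta (bigD1 1%g) //= big1 => [|g /negPf g1].
  by rewrite ffunE eqxx addr0 divfK // card_borel_neq0.
by rewrite ffunE g1.
Qed.

Fact W_block (x : W_mod) : e *: x = x.
Proof.
apply: W_incl_inj; rewrite [LHS]linearZ.
exact: (block1_ind_borel charRl odd_l l_dvd).
Qed.

Fact triv_block (x : triv_mod G R) : e *: x = x.
Proof. by have [_ ->] := block1_idemP G R. Qed.

Definition W_blk := BlockMod W_block.
Definition P_blk := BlockMod (@block1_ind_borel k R l charRl odd_l l_dvd).
Definition triv_blk := BlockMod triv_block.

Definition W_ob := @db_stalk _ _ W_blk (fingen_quot _ (ind_fg chi)).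
Definition P_ob := @db_stalk _ _ P_blk (ind_fg (linchar_one R (borel k))).
Definition triv_ob := @db_stalk _ _ triv_blk (triv_fg G R).

Lemma V_dsum : disomorphic (V_ob charRl odd_l l_dvd) (dsum triv_ob P_ob).
Proof.
apply: (@disomorphic_stalk_sum _ _ (BlockMod (V_block charRl odd_l l_dvd))
  triv_blk P_blk idfun) => // y.
by exists y.
Qed.

(** The first summand is only reduced modulo the annihilator, giving [W_mod]; on the second, the
    Frobenius map of [delta] identifies the reduction with [ind_borel] itself. *)
Definition Gamma_split_fun (x : Gamma_mod chi) : (W_mod * P)%type :=
  (quot_proj _ x.1, frob chi1 delta x.2).

Fact Gamma_split_linear : linear Gamma_split_fun.
Proof. by move=> a x y; congr (_, _); rewrite linearP. Qed.

Definition Gamma_split := mk_linear Gamma_split_linear.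

Lemma Gamma_split_ann x :
  x \in smem (ann_submodule P (Gamma_mod chi)) -> Gamma_split x = 0.
Proof.
move=> Ix; congr (_, _).
  apply/eqP; rewrite -(linear0 (quot_proj _)) quot_proj_eq subr0.
  exact: (ann_smul_map (fst : {linear Gamma_mod chi -> _}) Ix).
exact/frob_ann/(ann_smul_map (snd : {linear Gamma_mod chi -> _}) Ix).
Qed.

Definition Q_split : {linear Q_mod chi -> (W_mod * P)%type} :=
  quot_lift Gamma_split_ann.

Lemma Q_split_inj : injective Q_split.
Proof.
apply: quot_lift_inj => -[x y] [/eqP x0 y0].
have Iy : y \in smem (ann_submodule P (ind_mod chi1)).
  apply: (frob_ker card_unip_neq0 _ y0).
  by move=> v a; apply: delta_eps card_borel_neq0.
move: x0; rewrite -(linear0 (quot_proj _)) quot_proj_eq subr0 => Ix.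
(* Both inclusions into [Gamma_mod] are linear, so by [ann_smul_map] they carry the two
   componentwise memberships to membership of the pair. *)
have i1_lin : linear (fun z : ind_mod chi => (z, 0) : Gamma_mod chi).
  by move=> a u v; congr (_, _); rewrite /= scaler0 addr0.
have i2_lin : linear (fun z : ind_mod chi1 => (0, z) : Gamma_mod chi).
  by move=> a u v; congr (_, _); rewrite /= scaler0 addr0.
have -> : (x, y) = mk_linear i1_lin x + mk_linear i2_lin y.
  by congr (_, _); rewrite /= ?addr0 ?add0r.
by apply: rpredD; apply: ann_smul_map.
Qed.

Lemma Q_split_onto z : exists x, Q_split x = z.
Proof.
case: z => w v.
have [||y yv] := @frob_onto _ _ _ chi1 P delta card_unip_neq0 v.
- exact/equivariant_eps/delta_equivariant.
- exact: ind_genP.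
exists (quot_proj _ (quot_repr w, y)).
transitivity (Gamma_split (quot_repr w, y)).
  exact: (quot_lift_proj Gamma_split_ann).
by congr (_, _); first exact: quot_reprK.
Qed.

Lemma Q_dsum : disomorphic (Q_ob chi charRl odd_l l_dvd) (dsum W_ob P_ob).
Proof.
exact: (@disomorphic_stalk_sum _ _
  (BlockMod (Q_block charRl odd_l l_dvd (chi := chi))) W_blk P_blk
  Q_split Q_split_inj Q_split_onto).
Qed.

Lemma W_triv_ses (C : dbcat e -> Prop) : thick C -> C P_ob -> C W_ob <-> C triv_ob.
Proof.
move=> thickC.
apply: (@thick_stalk_ses _ _ _ W_blk P_blk triv_blk _ _ _ W_incl aug) => //.
- exact: W_incl_inj.
- exact: aug_onto.
- by move=> x; apply/W_incl_image; exists x.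
- by move=> y /W_incl_image.
Qed.

Lemma thick_Q_V (C : dbcat e -> Prop) : thick C ->
  C (Q_ob chi charRl odd_l l_dvd) <-> C (V_ob charRl odd_l l_dvd).
Proof.
move=> thickC; split=> [CQ | CV].
  have CW := thick_summand thickC Q_dsum CQ.
  have CP := thick_summand thickC (disomorphic_trans Q_dsum (dsumC _ _)) CQ.
  by apply: (thick_dsum thickC V_dsum _ CP); apply/W_triv_ses.
have CT := thick_summand thickC V_dsum CV.
have CP := thick_summand thickC (disomorphic_trans V_dsum (dsumC _ _)) CV.
by apply: (thick_dsum thickC Q_dsum _ CP); apply/W_triv_ses.
Qed.

End QAndV.

Theorem lemma4p13 (k : finFieldType) (R : closedFieldType) (l : nat)
    (charRl : l \in [pchar R]) (odd_l : odd l) (l_dvd : (l %| #|k|.+1)%N)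
    (chi : linchar R (unip k))
    (chi_nontriv : exists2 u, u \in unip k & chi u != 1) :
  forall X : dbcat (block1_idem {'GL_2[k]} R),
    thick_closure (Q_ob chi charRl odd_l l_dvd) X <->
    thick_closure (V_ob charRl odd_l l_dvd) X.
Proof.
(* Each closure is the intersection of the thick subcategories containing its generator, and by
   [thick_Q_V] these are the same for both generators. *)
move=> X; split=> clX C thickC CM; apply: clX => //.
  exact/(thick_Q_V charRl odd_l l_dvd chi_nontriv thickC).
exact/(thick_Q_V charRl odd_l l_dvd chi_nontriv thickC).
Qed.
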